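(* Let $K_1,K_2$ be two disjoint convex hypersurfaces in $\mathbb{R}^n$, bounding disjoint open convex sets $I_1,I_2$, let $\Omega$ be the associated space with its partial order $<$, and let $H$ be the timelike Euclidean Hilbert distance. The timelike Hilbert geometry has an underlying timelike Finsler structure given by the Minkowski functional \[ f_H(p,v)=f_{F_1^2}(p,v)+f_{F_2^1}(p,-v),\qquad p\in\Omega,\ v\in C(p). \] That is, $f_H(p,\cdot)$ is a timelike Minkowski functional on the cone $C(p)$ for each $p\in\Omega$, and for every $(p,q)\in\Omega\times\Omega$ with $p\le q$ one has $H(p,q)=\delta(p,q)$, where $\delta$ is the timelike intrinsic distance associated with $f_H$.
   Context: $I_1,I_2\subset\mathbb{R}^n$ are nonempty open convex sets (possibly unbounded) with $I_1\cap I_2=\emptyset$, $K_i=\partial I_i$ and $K_1\cap K_2=\emptyset$. A supporting hyperplane of $K_i$ is a hyperplane $\pi$ with $\pi\cap K_i\neq\emptyset$ and such that $I_i$ is contained in one of the two components of $\mathbb{R}^n\setminus\pi$. $d$ is Euclidean distance. An open segment $]a_1,a_2[$ is called admissible if $a_1\in K_1$, $a_2\in K_2$, $]a_1,a_2[\cap(K_1\cup K_2)=\emptyset$, and $]a_1,a_2[$ is not contained in any supporting hyperplane of $K_1$ or of $K_2$. $\Omega$ is the union of all admissible segments. For distinct $p,q\in\Omega$, $p<q$ means that there is an admissible segment $]a_1,a_2[$ containing $p$ and $q$ with $a_1,p,q,a_2$ collinear in that order. $p\le q$ means $p<q$ or $p=q$. Distances: for $p<q$ with $a_1,a_2$ the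 endpoints of the admissible segment containing $p,q$, put $F_1^2(p,q)=\log\frac{d(p,a_2)}{d(q,a_2)}$ and $\overline{F_1^2}(p,q)=F_2^1(q,p)=\log\frac{d(q,a_1)}{d(p,a_1)}$. The timelike Hilbert distance is $H(p,q)=\frac12\left(F_1^2(p,q)+\overline{F_1^2}(p,q)\right)$ for $p<q$, and $H(p,p)=0$. Functionals: $C(p)\subset T_p\Omega=\mathbb{R}^n$ consists of $0$ and of the nonzero $v$ such that $p+tv\in\Omega$ and $p<p+tv$ for some $t>0$. Let $K_1^2$ be the set of $k_2\in K_2$ such that there is $k_1\in K_1$ with $]k_1,k_2[\cap(K_1\cup K_2)=\emptyset$; let $\widetilde{I_2}$ be the intersection, over all supporting hyperplanes $\pi$ of $K_2$ at points of $K_1^2$, of the open half-spaces bounded by $\pi$ and containing $I_2$. Define $\widetilde{I_1}$ by exchanging the indices 1 and 2. For nonzero $v\in C(p)$, $f_{F_1^2}(p,v)=\sup\{\tau>0: p+v/\tau\in\overline{\widetilde{I_2}}\}$ and $f_{F_2^1}(p,-v)=\sup\{\tau>0: p-v/\tau\in\overline{\widetilde{I_1}}\}$, where the bar denotes closure; both are $0$ at $v=0$. (These are the functionals of the timelike relative Funk distance $F_1^2$ and of the reverse one $\overline{F_1^2}$.) A timelike Minkowski functional is a function $f$ defined on $C\cup\{O\}$, where $C\subset\mathbb{R}^n$ is a proper open convex cone with apex the origin $O$ (proper: it possesses a supporting hyperplane meeting it only at the apex), with $f(O)=0$, $f(x)>0$ for $x\in C$, $f(\lambda x)=\lambda f(x)$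 for $x\in C$ and $\lambda>0$, and $f((1-t)x+ty)>(1-t)f(x)+tf(y)$ for $x,y\in C$ and $0<t<1$. A piecewise $C^1$ curve $\sigma:[0,1]\to\Omega$ is timelike if $\sigma'(t)\in C(\sigma(t))$ for all $t$ (both one-sided derivatives at break points). For $p<q$ the timelike intrinsic distance is $\delta(p,q)=\sup_\sigma\int_0^1 f_H(\sigma(t),\sigma'(t))\,dt$, the supremum being over all timelike piecewise $C^1$ curves $\sigma:[0,1]\to\Omega$ with $\sigma(0)=p$ and $\sigma(1)=q$; $\delta(p,p)=0$.
   Formalization: The functional is taken as half of the displayed sum (without the factor 1/2 the intrinsic distance is 2H), and the strict concavity of a timelike Minkowski functional is replaced by the non-strict inequality, since homogeneity makes strictness fail for proportional vectors. *)

(* Defs.v *)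
From mathcomp Require Import all_boot all_order all_algebra.
From mathcomp Require Import all_classical all_reals all_analysis.

Set Implicit Arguments.
Unset Strict Implicit.
Unset Printing Implicit Defensive.
Import Order.TTheory GRing.Theory Num.Theory.
Import numFieldNormedType.Exports.

Local Open Scope classical_set_scope.
Local Open Scope ring_scope.

(* R^n is 'rV[R]_n.  Its library norm is the sup norm, which induces the
   Euclidean topology; the Euclidean inner product and distance are edot and
   edist below. *)

Section EuclideanSpace.
Context {R : realType} {n : nat}.
Implicit Types (x y u : 'rV[R]_n) (c : R) (A : set 'rV[R]_n).

Definition edot x y : R := \sum_(i < n) x ord0 i * y ord0 i.

Definition edist x y : R := Num.sqrt (edot (x - y) (x - y)).

Definition open_segment x y : set 'rV[R]_n :=
  [set (1 - t) *: x + t *: y | t in `]0, 1[].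

Definition boundary A : set 'rV[R]_n := closure A `\` interior A.

Definition hyperplane u c : set 'rV[R]_n := [set x | edot u x = c].

Definition half_space u c : set 'rV[R]_n := [set x | edot u x < c].

(* The hyperplane edot u x = c supports the boundary of A.  One of the two
   orientations suffices: (-u, -c) is the same hyperplane with the other
   component of its complement as half_space. *)
Definition supporting A u c : Prop :=
  [/\ u != 0, hyperplane u c `&` boundary A !=set0 & A `<=` half_space u c].

End EuclideanSpace.

Section MinkowskiFunctional.
Context {R : realType} {n : nat}.
Implicit Types (C : set 'rV[R]_n) (f : 'rV[R]_n -> R).

(* An open cone C does not contain its apex; the supporting hyperplane is
   required to meet C `|` [set 0] only at 0.  It may meet the closure of C
   elsewhere, so that an open half-space is allowed. *)
Definition proper_open_convex_cone C : Prop :=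
  [/\ C !=set0, open C, convex_set C,
      forall (l : R) x, 0 < l -> C x -> C (l *: x) &
      exists u : 'rV[R]_n, [/\ u != 0, forall x, C x -> 0 <= edot u x &
        hyperplane u 0 `&` (C `|` [set 0]) = [set 0]]].

(* Superadditivity cannot be strict: for y = l x, l > 0, homogeneity forces
   equality in the last clause. *)
Definition timelike_Minkowski_functional C f : Prop :=
  [/\ proper_open_convex_cone C,
      f 0 = 0,
      forall x, C x -> 0 < f x,
      forall x (l : R), C x -> 0 < l -> f (l *: x) = l * f x &
      forall x y (t : R), C x -> C y -> 0 < t -> t < 1 ->
        (1 - t) * f x + t * f y <= f ((1 - t) *: x + t *: y)].

End MinkowskiFunctional.

Section PiecewiseC1.
Context {R : realType} {n : nat}.
Implicit Types (sigma g : R -> 'rV[R]_n) (a b t : R) (v : 'rV[R]_n).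

Definition right_derivative sigma t v : Prop :=
  (fun h : R => h^-1 *: (sigma (t + h) - sigma t)) @ 0^'+ --> v.

Definition left_derivative sigma t v : Prop :=
  (fun h : R => h^-1 *: (sigma (t + h) - sigma t)) @ 0^'- --> v.

Definition C1_on sigma a b : Prop :=
  exists g, [/\ {within `[a, b], continuous g},
    forall t, a <= t < b -> right_derivative sigma t (g t) &
    forall t, a < t <= b -> left_derivative sigma t (g t)].

Definition piecewise_C1 sigma : Prop :=
  exists2 s : seq R, itv_partition 0 1 s &
    forall i : nat, (i < size s)%N ->
      C1_on sigma (nth 0 (0 :: s) i) (nth 0 s i).

End PiecewiseC1.

Section TimelikeHilbert.
Context {R : realType} {n : nat}.
Notation E := 'rV[R]_n.
Implicit Types (I J : set E) (p q v : E).

Definition admissible I1 I2 (a1 a2 : E) : Prop :=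
  [/\ boundary I1 a1, boundary I2 a2,
      open_segment a1 a2 `&` (boundary I1 `|` boundary I2) = set0,
      forall u c, supporting I1 u c -> ~ open_segment a1 a2 `<=` hyperplane u c &
      forall u c, supporting I2 u c -> ~ open_segment a1 a2 `<=` hyperplane u c].

Definition Omega I1 I2 : set E :=
  [set p | exists a1 a2, admissible I1 I2 a1 a2 /\ open_segment a1 a2 p].

Definition admissible_through I1 I2 p q (a1 a2 : E) : Prop :=
  admissible I1 I2 a1 a2 /\
  exists s t : R, [/\ 0 < s, s < t, t < 1,
    p = (1 - s) *: a1 + s *: a2 & q = (1 - t) *: a1 + t *: a2].

Definition precedes I1 I2 p q : Prop :=
  exists a1 a2, admissible_through I1 I2 p q a1 a2.

Definition preceq I1 I2 p q : Prop := precedes I1 I2 p q \/ p = q.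

(* The endpoints are unique when precedes I1 I2 p q; otherwise this is the
   dummy value (0, 0). *)
Definition endpoints I1 I2 p q : E * E :=
  xget (0, 0) [set a | admissible_through I1 I2 p q a.1 a.2].

Definition F12 I1 I2 p q : R :=
  let a2 := (endpoints I1 I2 p q).2 in ln (edist p a2 / edist q a2).

Definition F12bar I1 I2 p q : R :=
  let a1 := (endpoints I1 I2 p q).1 in ln (edist q a1 / edist p a1).

Definition H I1 I2 p q : R :=
  if p == q then 0 else 2^-1 * (F12 I1 I2 p q + F12bar I1 I2 p q).

Definition cone_at I1 I2 p : set E :=
  [set v | v = 0 \/ v != 0 /\ exists t : R,
    [/\ 0 < t, Omega I1 I2 (p + t *: v) & precedes I1 I2 p (p + t *: v)]].

(* With boundaries K, L of I, J: visible I J is K_K^L, the part of L that is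
   visible from K, and hull I J is the J-side hull it determines.  Thus
   hull I1 I2 is the set I_2 tilde, and hull I2 I1 is I_1 tilde. *)
Definition visible I J : set E :=
  [set k | boundary J k /\ exists2 k', boundary I k' &
    open_segment k' k `&` (boundary I `|` boundary J) = set0].

Definition hull I J : set E :=
  [set x | forall u c, supporting J u c ->
    hyperplane u c `&` visible I J !=set0 -> half_space u c x].

Definition funk_functional I J p v : R :=
  if v == 0 then 0
  else sup [set tau : R | 0 < tau /\ closure (hull I J) (p + tau^-1 *: v)].

(* The two summands integrate to F12 and F12bar along line segments; the factor
   1/2 is the one in the definition of H. *)
Definition f_H I1 I2 p v : R :=
  2^-1 * (funk_functional I1 I2 p v + funk_functional I2 I1 p (- v)).

Definition timelike_curve I1 I2 (sigma : R -> E) : Prop :=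
  [/\ piecewise_C1 sigma,
      forall t, 0 <= t <= 1 -> Omega I1 I2 (sigma t),
      forall t v, 0 <= t < 1 -> right_derivative sigma t v ->
        cone_at I1 I2 (sigma t) v &
      forall t v, 0 < t <= 1 -> left_derivative sigma t v ->
        cone_at I1 I2 (sigma t) v].

(* At the finitely many t where sigma need not be differentiable, sigma^`() t
   is a dummy value; this does not affect the integral. *)
Definition curve_length I1 I2 (sigma : R -> E) : \bar R :=
  (\int[lebesgue_measure]_(t in `[0%R, 1%R])
     (f_H I1 I2 (sigma t) (derive1 sigma t))%:E)%E.

Definition delta I1 I2 p q : \bar R :=
  if p == q then 0%E else
  ereal_sup [set curve_length I1 I2 sigma | sigma in
    [set sigma | [/\ timelike_curve I1 I2 sigma, sigma 0 = p & sigma 1 = q]]].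

End TimelikeHilbert.

(* Main.v *)
(** For [p] in [Omega] and [v] in the cone at [p], let [p + s2 v] be the point
    where the ray meets the boundary of [I2]. As this point is visible, the hull
    has a supporting hyperplane there, so the Funk functional is simply [1 / s2].
    For every supporting hyperplane [u = c] with [u p > c] one has
    [1 / s2 <= - u v / (u p - c)], with equality if it passes through
    [p + s2 v]; this gives concavity. Along a timelike curve [sigma] that ends at
    [q], take the hyperplane through the end point of the segment from [p] to [q]:
    [u sigma - c] decreases wherever it is positive and it is positive at [q],
    hence it is positive throughout, and the bound is the derivative of
    [- ln (u sigma - c)]. Integrating it and its mirror image for [I1] bounds the
    length of [sigma] by [H p q], which the straight segment attains. *)

Require Import Defs.
From mathcomp Require Import all_boot all_order all_algebra.
From mathcomp Require Import all_classical all_reals all_analysis.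
From mathcomp Require Import measurable_realfun ring lra.
Import Order.TTheory GRing.Theory Num.Theory.
Import numFieldNormedType.Exports.
Local Open Scope classical_set_scope.
Local Open Scope ring_scope.

Set Implicit Arguments.
Unset Strict Implicit.
Unset Printing Implicit Defensive.

(** * Convex sets and separation in Euclidean space *)

Section EuclideanProduct.
Context {R : realType} {n : nat}.
Implicit Types (x y z u v : 'rV[R]_n) (a c t : R).

Lemma edotC x y : edot x y = edot y x.
Proof. by apply: eq_bigr => i _; rewrite mulrC. Qed.

Lemma edotDr u x y : edot u (x + y) = edot u x + edot u y.
Proof. by rewrite -big_split; apply: eq_bigr => i _; rewrite mxE mulrDr. Qed.

Lemma edotZr u a x : edot u (a *: x) = a * edot u x.
Proof. by rewrite mulr_sumr; apply: eq_bigr => i _; rewrite mxE mulrCA. Qed.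

Lemma edotNr u x : edot u (- x) = - edot u x.
Proof. by rewrite -scaleN1r edotZr mulN1r. Qed.

Lemma edotBr u x y : edot u (x - y) = edot u x - edot u y.
Proof. by rewrite edotDr edotNr. Qed.

Lemma edot0r u : edot u 0 = 0.
Proof. by rewrite -(scale0r 0) edotZr mul0r. Qed.

Lemma edotDl u x y : edot (x + y) u = edot x u + edot y u.
Proof. by rewrite !(edotC _ u) edotDr. Qed.

Lemma edotZl u a x : edot (a *: x) u = a * edot x u.
Proof. by rewrite !(edotC _ u) edotZr. Qed.

Lemma edotNl u x : edot (- x) u = - edot x u.
Proof. by rewrite !(edotC _ u) edotNr. Qed.

Definition edotE := (edotDr, edotDl, edotNr, edotNl, edotZr, edotZl).

Lemma edot_sqrD x y t : edot (x + t *: y) (x + t *: y) =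
  edot x x + 2 * t * edot x y + t ^+ 2 * edot y y.
Proof. by rewrite !edotE (edotC y x); ring. Qed.

Lemma sqr_coord_le_edot x i : x ord0 i ^+ 2 <= edot x x.
Proof.
rewrite /edot (bigD1 i)//= -expr2 lerDl sumr_ge0// => j _.
by rewrite -expr2 sqr_ge0.
Qed.

Lemma edot_ge0 x : 0 <= edot x x.
Proof. by apply: sumr_ge0 => i _; rewrite -expr2 sqr_ge0. Qed.

Lemma edot_gt0 x : x != 0 -> 0 < edot x x.
Proof.
move=> x0; rewrite lt_neqAle edot_ge0 andbT eq_sym; apply: contra_neq x0 => e0.
apply/rowP => i; rewrite mxE; apply/eqP; rewrite -sqrf_eq0 eq_le sqr_ge0 andbT.
by rewrite -e0 sqr_coord_le_edot.
Qed.

Lemma cvg_edot (T : Type) (F : set_system T) {FF : Filter F}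
    (f g : T -> 'rV[R]_n) x y :
  f @ F --> x -> g @ F --> y -> edot (f t) (g t) @[t --> F] --> edot x y.
Proof.
move=> fx gy; apply: cvg_big => [|i _]; first exact: add_continuous.
by apply: cvgM;
  apply: (@continuous_cvg _ _ _ F FF _ (fun M : 'rV[R]_n => M ord0 i)) => //;
  exact: coord_continuous.
Qed.

Lemma edot_continuous u : continuous (edot u).
Proof. by move=> x; apply: (@cvg_edot _ (nbhs x) _ (fun=> u) id);
  [exact: (@cvg_cst _ u _ (nbhs x))|exact: cvg_id]. Qed.

Lemma edistZ a x y :
  0 <= a -> Defs.edist (y + a *: x) y = a * Defs.edist x 0.
Proof.
move=> a0; rewrite /Defs.edist addrAC subrr add0r subr0 !edotE mulrA -expr2.
by rewrite sqrtrM ?sqr_ge0// sqrtr_sqr ger0_norm.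
Qed.

End EuclideanProduct.

(** * Segments and rays in open convex sets *)

Section ConvexSets.
Context {R : realType} {n : nat}.
Implicit Types (A : set 'rV[R]_n) (p x y u v w : 'rV[R]_n) (s t T : R).

Lemma convex_comb A : convex_set A -> forall x y (a b : R),
  A x -> A y -> 0 < a -> 0 < b -> A ((a + b)^-1 *: (a *: x + b *: y)).
Proof.
move=> cA x y a b Ax Ay a0 b0.
have ab0 : 0 < a + b by rewrite addr_gt0.
have a01 : 0 <= a / (a + b) by rewrite divr_ge0// ltW.
have a11 : a / (a + b) <= 1 by rewrite ler_pdivrMr// mul1r lerDl ltW.
have := cA x y (Itv01 a01 a11) (mem_set Ax) (mem_set Ay).
rewrite inE /conv/= /unstable.onem; congr (A _).
rewrite scalerDr !scalerA mulrC; congr (_ + _ *: _).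
by field; rewrite gt_eqF.
Qed.

Lemma convex_comb1 {A} : convex_set A -> forall x y t,
  A x -> A y -> 0 < t -> t < 1 -> A ((1 - t) *: x + t *: y).
Proof.
move=> cA x y t Ax Ay t0 t1.
have t1' : 0 < 1 - t by rewrite subr_gt0.
by have := convex_comb cA Ax Ay t1' t0; rewrite subrK invr1 scale1r.
Qed.

Lemma cvg_line (U : Type) (F : set_system U) {FF : Filter F}
    (f : U -> R) (g : U -> 'rV[R]_n) p (a : R) v :
  f @ F --> a -> g @ F --> v -> p + f t *: g t @[t --> F] --> p + a *: v.
Proof.
move=> fa gv; apply: (@cvgD _ _ _ F FF (fun=> p)); first exact: cvg_cst.
exact: cvgZ.
Qed.

Lemma open_preimage_affine A (c : R) y : open A -> open [set x | A (y + c *: x)].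
Proof.
move=> oA; apply: (open_comp (f := fun x => y + c *: x)) => // x _.
by apply: (@cvg_line _ (nbhs x) _ (fun=> c) id);
  [exact: (@cvg_cst _ c _ (nbhs x))|exact: cvg_id].
Qed.

(** Keep the combination [z] fixed and move [y] to a nearby point [y'] of [A]: the other end must
    then be [f y']. As [f y = x] and [A] is open, [f y'] still lies in [A] for [y'] close to [y], so
    [z] is a combination of two points of [A]. *)
Lemma open_convex_closure_comb A : open A -> convex_set A ->
  forall x y t, A x -> closure A y -> 0 <= t -> t < 1 ->
  A ((1 - t) *: x + t *: y).
Proof.
move=> oA cA x y t Ax clAy.
rewrite le_eqVlt => /predU1P[<- _|t0 t1]; first by rewrite subr0 scale1r scale0r addr0.
have t1' : 0 < 1 - t by rewrite subr_gt0.
have t1n : 1 - t != 0 by rewrite gt_eqF.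
set z := (1 - t) *: x + t *: y.
pose f := fun y' : 'rV[R]_n => (1 - t)^-1 *: z + (- (t / (1 - t))) *: y'.
have fy : f y = x.
  rewrite /f /z scalerDr !scalerA mulVf// scale1r -addrA -scalerDl.
  by rewrite [X in X *: y](_ : _ = 0) ?scale0r ?addr0//; ring.
have Afy : nbhs y [set y' | A (f y')].
  apply: open_nbhs_nbhs; split; last by rewrite /= fy.
  exact: open_preimage_affine.
have [y' [Ay' Afy']] := clAy _ Afy.
have := convex_comb1 cA Afy' Ay' t0 t1.
congr (A _); rewrite /f scalerDr !scalerA divff// scale1r -addrA -scalerDl.
by rewrite [X in X *: y'](_ : _ = 0) ?scale0r ?addr0//; field.
Qed.

(** The point at [s] is a combination of the point of [A] at [T] and the closure point at [r], with
    weight less than 1 on the latter. Thus a ray that ends in [A] crosses the boundary at most once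
    on its way. *)
Lemma open_convex_ray A : open A -> convex_set A -> forall p v r s T,
  closure A (p + r *: v) -> A (p + T *: v) -> r < s -> s <= T -> A (p + s *: v).
Proof.
move=> oA cA p v r s T clr AT rs sT.
have rT : 0 < T - r by rewrite subr_gt0 (lt_le_trans rs).
have q0 : 0 <= (T - s) / (T - r) by rewrite divr_ge0 ?subr_ge0// ltW// -subr_gt0.
have q1 : (T - s) / (T - r) < 1 by rewrite ltr_pdivrMr// mul1r ltrD2l ltrN2.
have := open_convex_closure_comb oA cA AT clr q0 q1; congr (A _).
rewrite !scalerDr !scalerA addrACA -!scalerDl subrK scale1r; congr (_ + _ *: _).
by field; rewrite gt_eqF.
Qed.

Lemma boundary_openE A x : open A -> boundary A x <-> closure A x /\ ~ A x.
Proof. by move=> /interior_id AE; rewrite /boundary AE. Qed.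

(** Take the least parameter in [[0, T]] at which the ray lies in the closure, which exists by
    compactness. It is positive since [p] is outside the closure; were its point in [A], openness
    would give a smaller parameter. *)
Lemma ray_hits_boundary A : open A -> convex_set A -> forall p v T,
  0 < T -> ~ closure A p -> A (p + T *: v) ->
  exists s, [/\ 0 < s, s < T & boundary A (p + s *: v)].
Proof.
move=> oA cA p v T T0 clp AT.
pose f := fun r : R => p + r *: v.
have cf : continuous f.
  by move=> r; apply: (@cvg_line _ (nbhs r) _ id (fun=> v)); [exact: cvg_id|exact: cvg_cst].
pose S := `[0, T]%classic `&` f @^-1` closure A.
have cS : compact S.
  apply: (subclosed_compact _ (@segment_compact _ 0 T)); last exact: subIsetl.
  apply: closedI; first exact: itv_closed.
  by apply: closed_comp => [r _|]; [exact: cf|exact: closed_closure].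
have ST : S T by split; [rewrite /= in_itv/= lexx ltW|exact: subset_closure].
have [|s] := @compact_EVT_min _ R id S (ex_intro _ _ ST) cS.
  by apply: continuous_subspaceT => r; exact: cvg_id.
move=> /set_mem Ss smin; have [s0T cls] := Ss.
have /andP[s0 sT] : 0 <= s <= T by [].
have {}cls : closure A (p + s *: v) by [].
have s0' : 0 < s.
  rewrite lt_neqAle s0 andbT; apply: contra_notN clp => /eqP s00.
  by move: cls; rewrite -s00 scale0r addr0.
have nAs : ~ A (f s).
  move=> As.
  have nA : \forall r \near s, A (f r).
    have oS : open (f @^-1` A) := open_comp (fun r _ => cf r) oA.
    exact: open_nbhs_nbhs (conj oS As).
  have nA' : \forall r \near s^'-, [/\ A (f r), 0 < r & r < s].
    near=> r; split; near: r.
    - exact: (cvg_within _ nA).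
    - exact: nbhs_left_gt.
    - exact: nbhs_left_lt.
  have [r [Ar r0 rs]] := @filter_ex _ _ (at_left_proper_filter s) _ nA'.
  have : s <= r.
    apply/smin/mem_set; split; last exact: subset_closure.
    by rewrite /= in_itv/= ltW//= (le_trans (ltW rs)).
  by rewrite leNgt rs.
exists s; split => //; last by apply/boundary_openE.
by rewrite lt_neqAle sT andbT; apply: contra_notN nAs => /eqP ->.
Unshelve. all: by end_near. Qed.

End ConvexSets.

(** * Separating and supporting hyperplanes by distance minimization *)

Section Separation.
Context {R : realType} {n : nat}.
Implicit Types (A C D : set 'rV[R]_n) (a b p x y u v w z : 'rV[R]_n).

(** The part of [C] no farther from [b] than a given point [x0] of [C] is compact, and a minimum
    over it is a minimum over [C]. *)
Lemma nearest_point C b : C !=set0 -> closed C ->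
  exists2 z, C z & forall x, C x -> edot (z - b) (z - b) <= edot (x - b) (x - b).
Proof.
move=> [x0 Cx0] clC.
pose e x := edot (x - b) (x - b).
have ce : continuous e.
  by move=> x; apply: (@cvg_edot _ _ _ (nbhs x) _ (fun x => x - b) (fun x => x - b));
    apply: (@cvgB _ _ _ _ _ id (fun=> b));
    do ?[exact: cvg_id|exact: (@cvg_cst _ b _ (nbhs x))].
pose S := C `&` [set x | e x <= e x0].
have cS : compact S.
  apply: bounded_closed_compact.
    exists (`|b| + e x0 + 1); split; first exact: num_real.
    move=> M ltM x [_ /= ex].
    (* Each coordinate [c] satisfies [|c| <= c ^+ 2 + 1], which bounds the sup norm without square
       roots. *)
    have xb : `|x - b| <= e x0 + 1.
      rewrite [leLHS]/Num.Def.normr /= mx_normrE; apply/bigmax_leP => /=; split.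
        by rewrite addr_ge0// edot_ge0.
      move=> [i j] _ /=; rewrite ord1; set c := (x - b) _ _.
      have : c ^+ 2 <= e x0 by apply: le_trans ex; exact: sqr_coord_le_edot.
      by rewrite -real_normK ?num_real//; have := normr_ge0 c; nra.
    rewrite -(subrK b x) (le_trans (ler_normD _ _))// ltW//.
    by apply: le_lt_trans ltM; rewrite addrC -addrA lerD2l.
  by apply: closedI => //; exact: closed_comp (fun x _ => ce x) (@closed_le R _).
have S0 : S !=set0 by exists x0; split => /=.
have [|z] := EVT_min_rV S0 cS (f := e); first exact: continuous_subspaceT.
move=> /set_mem[Cz ez] zmin; exists z => // x Cx.
have [exx0|] := leP (e x) (e x0); first by apply/zmin/mem_set.
by move=> /ltW; exact: le_trans.
Qed.

Lemma open_line A x v : open A -> A x -> exists2 h : R, 0 < h & A (x + h *: v).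
Proof.
move=> oA Ax; pose f := fun h : R => x + h *: v.
have cf : continuous f.
  by move=> r; apply: (@cvg_line _ _ _ (nbhs r) _ id (fun=> v));
    [exact: cvg_id|exact: cvg_cst].
have oS : open (f @^-1` A) := open_comp (fun r _ => cf r) oA.
have A0 : (f @^-1` A) 0 by rewrite /= /f scale0r addr0.
have near0 := open_nbhs_nbhs (conj oS A0).
have nA : \forall h \near (0 : R)^'+, 0 < h /\ A (f h).
  near=> h; split; near: h; first exact: nbhs_right_gt.
  exact: (cvg_within _ near0).
have [h [h0 Ah]] := @filter_ex _ _ (at_right_proper_filter 0) _ nA.
by exists h.
Unshelve. all: by end_near. Qed.

(* The directions in which the affine subspace through [a] parallel to [w] has
   a translate meeting [A]; for [w = 0], the cone over [A] with apex [a]. *)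
Definition dir_cone A a w : set 'rV[R]_n :=
  [set y | exists l m : R, 0 < l /\ A (a + m *: w + l *: y)].

Lemma open_dir_cone A a w : open A -> open (dir_cone A a w).
Proof.
move=> oA.
rewrite (_ : dir_cone A a w = \bigcup_(lm in [set lm : R * R | 0 < lm.1])
    [set y | A (a + lm.2 *: w + lm.1 *: y)]).
  by apply: bigcup_open => -[l m] _; exact: open_preimage_affine.
apply/seteqP; split => y /=.
  by move=> [l [m [l0 Ay]]]; exists (l, m).
by move=> [[l m] /= l0 Ay]; exists l, m.
Qed.

Lemma dir_coneZ A a w t y : 0 < t -> dir_cone A a w y -> dir_cone A a w (t *: y).
Proof.
move=> t0 [l [m [l0 Ay]]]; exists (l / t), m; split; first exact: divr_gt0.
by rewrite scalerA divfK// gt_eqF.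
Qed.

Lemma dir_coneD A a w x y : convex_set A ->
  dir_cone A a w x -> dir_cone A a w y -> dir_cone A a w (x + y).
Proof.
move=> cA [k [r [k0 Ax]]] [l [m [l0 Ay]]].
have ki : 0 < k^-1 by rewrite invr_gt0.
have li : 0 < l^-1 by rewrite invr_gt0.
have kl : k^-1 + l^-1 != 0 by rewrite gt_eqF// addr_gt0.
(* Weights proportional to [k^-1] and [l^-1] give [x] and [y] the same coefficient in the convex
   combination. *)
exists (k^-1 + l^-1)^-1, ((k^-1 + l^-1)^-1 * (k^-1 * r + l^-1 * m)).
split; first by rewrite invr_gt0 addr_gt0.
have := convex_comb cA Ax Ay ki li; congr (A _).
rewrite !scalerDr !scalerA !mulVf ?gt_eqF// mulr1.
apply/rowP => i; rewrite !mxE; move: (k^-1) (l^-1) kl => K L KL.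
by field.
Qed.

Lemma dir_cone_convex A a w : convex_set A -> convex_set (dir_cone A a w).
Proof.
move=> cA; apply/convex_setW => x y /set_mem Ax /set_mem Ay t t0 t1.
apply/mem_set/dir_coneD => //; apply: dir_coneZ => //.
by rewrite /unstable.onem subr_gt0.
Qed.

(* Minimizing the distance to [- w0] over the closure of the open convex cone
   [D], where [D w0], yields the separating functional: [- w0] is not in that
   closure since otherwise [D] would contain the midpoint [0]. *)
Lemma open_convex_cone_neg D : D !=set0 -> open D -> convex_set D ->
  (forall t x, 0 < t -> D x -> D (t *: x)) -> ~ D 0 ->
  exists u, forall x, D x -> edot u x < 0.
Proof.
move=> [w0 Dw0] oD cD DZ D0.
have clw : ~ closure D (- w0).
  move=> clw; have h0 : 0 <= 2^-1 :> R by rewrite invr_ge0.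
  have h1 : 2^-1 < 1 :> R by rewrite invf_lt1// ltr1n.
  apply: D0; have := open_convex_closure_comb oD cD Dw0 clw h0 h1.
  congr (D _); rewrite scalerN -scalerBl.
  by rewrite [X in X *: _](_ : _ = 0) ?scale0r//; field.
have [|z clz zmin] := @nearest_point (closure D) (- w0) _ (@closed_closure _ D).
  by exists w0; exact: subset_closure.
set e := z - - w0 in zmin.
have e0 : 0 < edot e e.
  apply: edot_gt0; rewrite subr_eq0; apply: contra_notN clw => /eqP <-.
  exact: clz.
have ez x : D x -> edot e z <= edot e x.
  move=> Dx; rewrite -subr_ge0 -edotBr leNgt; apply/negP => ex.
  set g := edot (x - z) (x - z).
  have g0 : 0 <= g by exact: edot_ge0.
  (* Moving from [z] towards [x] by [t] changes the squared distance by
     [2 * t * edot e (x - z) + t ^+ 2 * g]. This choice has [0 < t <= 1] and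
     [t * g <= - edot e (x - z)], so the change is negative, contradicting minimality. *)
  pose t := - edot e (x - z) / (- edot e (x - z) + g).
  have d0 : 0 < - edot e (x - z) + g by rewrite ltr_wpDr// oppr_gt0.
  have t0 : 0 < t by rewrite divr_gt0// oppr_gt0.
  have t1 : t <= 1 by rewrite ler_pdivrMr// mul1r lerDl.
  have Dt : D ((1 - (1 - t)) *: x + (1 - t) *: z).
    by apply: open_convex_closure_comb => //; rewrite ?subr_ge0// gtrBl.
  have := zmin _ (subset_closure Dt).
  rewrite [X in _ <= edot X X](_ : _ = e + t *: (x - z)); last first.
    by apply/rowP => i; rewrite !mxE; ring.
  rewrite edot_sqrD -/g.
  have gt : t * g <= - edot e (x - z).
    have a0 : 0 < - edot e (x - z) by rewrite oppr_gt0.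
    by rewrite /t mulrAC ler_pdivrMr// ler_pM2l// lerDr ltW.
  by nra.
(* By [ez] the functional is bounded below on [D]; since [D] is a cone, a negative value could be
   scaled below any bound. *)
have Dge x : D x -> 0 <= edot e x.
  move=> Dx; rewrite leNgt; apply/negP => ex.
  have k0 : 0 < 1 + `|edot e z| / - edot e x.
    by rewrite ltr_pwDl// divr_ge0// oppr_ge0 ltW.
  have := ez _ (DZ _ _ k0 Dx).
  rewrite edotZr mulrDl mul1r invrN mulrN mulNr divfK ?lt_eqF//.
  by have := ler_norm (- edot e z); rewrite normrN; lra.
exists (- e) => x Dx; rewrite edotNl oppr_lt0 lt_neqAle Dge// andbT.
(* A zero value is excluded by openness: a small move along [- e] would make it negative. *)
apply/negP => /eqP ex0.
have [h h0 /Dge] := open_line (- e) oD Dx.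
by rewrite edotDr edotZr edotNr -ex0 add0r mulrN oppr_ge0 leNgt mulr_gt0.
Qed.

(** The cone [dir_cone A a w] is open, convex and misses [0], so some [u] is negative on it. It
    contains the whole line [x - a + m *: w] for each [x] in [A], and [u] can stay negative on a
    line only if it vanishes on [w]. *)
Lemma open_convex_separation A a w : A !=set0 -> open A -> convex_set A ->
  (forall m : R, ~ A (a + m *: w)) ->
  exists u, edot u w = 0 /\ forall x, A x -> edot u x < edot u a.
Proof.
move=> [x0 Ax0] oA cA Aaw.
have DA x (m : R) : A x -> dir_cone A a w (x - a + m *: w).
  move=> Ax; exists 1, (- m); split => //.
  rewrite [X in A X](_ : _ = x)//.
  by apply/rowP => i; rewrite !mxE; ring.
have D0 : ~ dir_cone A a w 0 by move=> [l [m [_]]]; rewrite scaler0 addr0; exact: Aaw.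
have Dne : dir_cone A a w !=set0 by exists (x0 - a + 0 *: w); exact: DA.
have [u uD] := open_convex_cone_neg Dne (open_dir_cone (a := a) (w := w) oA)
  (dir_cone_convex (a := a) (w := w) cA) (fun t x => @dir_coneZ A a w t x) D0.
exists u; split; last first.
  move=> x Ax; have := uD _ (DA _ 0 Ax).
  by rewrite scale0r addr0 edotBr subr_lt0.
apply/eqP/negPn/negP => uw.
(* For this multiple of [w] the value of [u] would be [0]. *)
have := uD _ (DA _ (- edot u (x0 - a) / edot u w) Ax0).
by rewrite edotDr edotZr divfK// subrr ltxx.
Qed.

Lemma supporting_exists A a : A !=set0 -> open A -> convex_set A ->
  boundary A a -> exists u, supporting A u (edot u a).
Proof.
move=> A0 oA cA Aa; have [_ nAa] := (boundary_openE a oA).1 Aa.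
have [|u [_ uA]] := @open_convex_separation A a 0 A0 oA cA.
  by move=> m; rewrite scaler0 addr0.
exists u; split => //; last by exists a.
case: A0 => x /uA; apply: contraTneq => ->.
by rewrite !(edotC 0) !edot0r ltxx.
Qed.

End Separation.

(** * Admissible segments and the Funk functionals *)

Section Omega.
Context {R : realType} {n : nat}.
Implicit Types (A I J : set 'rV[R]_n) (a b p q u v w x : 'rV[R]_n) (s t c : R).

(** The hypotheses in a form symmetric under exchange of the two sets, so that each one-sided result
    also serves for the other side. *)
Definition convex_pair I J : Prop :=
  [/\ I !=set0 /\ J !=set0, open I /\ open J, convex_set I /\ convex_set J &
      closure I `&` closure J = set0].

Lemma convex_pairC I J : convex_pair I J -> convex_pair J I.
Proof. by move=> [[? ?] [? ?] [? ?] ?]; split => //; rewrite setIC. Qed.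

(** A point of the open set [I] in the closure of [J] would have points of [J] near it inside [I].
    Hence a common closure point lies on both boundaries. *)
Lemma disjoint_closure I J : open I -> open J -> I `&` J = set0 ->
  boundary I `&` boundary J = set0 -> closure I `&` closure J = set0.
Proof.
move=> oI oJ IJ bIJ; rewrite -subset0 => x [clI clJ].
have nI : ~ I x.
  move=> Ix; have [y [Jy Iy]] := clJ _ (open_nbhs_nbhs (conj oI Ix)).
  by have : (I `&` J) y by []; rewrite IJ.
have nJ : ~ J x.
  move=> Jx; have [y [Iy Jy]] := clI _ (open_nbhs_nbhs (conj oJ Jx)).
  by have : (I `&` J) y by []; rewrite IJ.
by rewrite -bIJ; split; apply/boundary_openE.
Qed.

Lemma open_segmentC a b : open_segment a b = open_segment b a.
Proof.
by apply/seteqP; split => x [t]; rewrite /= in_itv/= => /andP[t0 t1] <-;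
  (exists (1 - t); first by rewrite /= in_itv/= subr_gt0 t1 gtrBl);
  rewrite subKr addrC.
Qed.

Lemma admissibleC I J a b : admissible I J a b -> admissible J I b a.
Proof.
by move=> [Ia Jb IJ0 HI HJ]; split => //; rewrite open_segmentC // setUC.
Qed.

Lemma OmegaC I J : Omega I J = Omega J I.
Proof.
by apply/seteqP; split => p [a [b [adm ab]]]; exists b, a;
  (split; first exact: admissibleC); rewrite open_segmentC.
Qed.

Lemma closure_supporting A u c x :
  A `<=` half_space u c -> closure A x -> edot u x <= c.
Proof.
move=> Auc; have cl : closed [set y | edot u y <= c].
  exact: closed_comp (fun y _ => @edot_continuous _ _ u y) (@closed_le R c).
move=> Ax; suff : [set y | edot u y <= c] x by [].
by rewrite ((closure_id _).1 cl); apply: closureS Ax => y /Auc /ltW.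
Qed.

Lemma admissible_visible I J a b : admissible I J a b -> visible I J b.
Proof. by move=> [Ia Jb ab0 _ _]; split => //; exists a. Qed.

Lemma line_param p v s1 s2 r : 0 < s1 + s2 ->
  p + r *: v = (1 - (s1 + r) / (s1 + s2)) *: (p - s1 *: v) +
               ((s1 + r) / (s1 + s2)) *: (p + s2 *: v).
Proof.
by move=> s0; apply/rowP => i; rewrite !mxE; field; rewrite gt_eqF.
Qed.

Lemma open_segment_hyperplane a b u c : open_segment a b `<=` hyperplane u c ->
  edot u a = c /\ edot u b = c.
Proof.
move=> ab.
have E t : 0 < t < 1 -> (1 - t) * edot u a + t * edot u b = c.
  move=> t01; have := ab ((1 - t) *: a + t *: b).
  rewrite /hyperplane/= edotDr !edotZr; apply.
  by exists t => //=; rewrite in_itv.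
(* Two interior parameters, one and two thirds, determine an affine function and hence its values at
   the ends. *)
by have := E 3^-1; have := E (2 * 3^-1); lra.
Qed.

(** This is where transversality to supporting hyperplanes enters. If the line through [a] and [b]
    missed [I], separation along [b - a] would give a supporting hyperplane containing the segment.
    So the line meets [I] at some parameter [m], and the other conditions leave only [m < 0]. *)
Lemma admissible_beyond I J a b : convex_pair I J -> admissible I J a b ->
  exists2 e, 0 < e & I (a - e *: (b - a)).
Proof.
move=> [[I0 _] [oI _] [cI _] IJ0] [Ia Jb abIJ supI _].
have [clIa nIa] := (boundary_openE a oI).1 Ia.
have nclIb : ~ closure I b.
  move=> clIb; have : (closure I `&` closure J) b by split => //; case: Jb.
  by rewrite IJ0.
have [[m Im]|noI] := pselect (exists m : R, I (a + m *: (b - a))); last first.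
  have [|u [uab uI]] := @open_convex_separation _ _ I a (b - a) I0 oI cI.
    by move=> m Im; apply: noI; exists m.
  have u0 : u != 0.
    case: I0 => x /uI; apply: contraTneq => ->.
    by rewrite !(edotC 0) !edot0r ltxx.
  have /supI : supporting I u (edot u a) by split => //; exists a.
  case => x [t _ <-]; rewrite /hyperplane/=.
  move/eqP: uab; rewrite edotBr subr_eq0 edotDr !edotZr => /eqP ->.
  by rewrite -mulrDl subrK mul1r.
have [m0|m0|m0] := ltgtP m 0; last by move: Im; rewrite m0 scale0r addr0.
  by exists (- m); rewrite ?oppr_gt0// scaleNr opprK.
(* For [0 < m < 1] the ray from [b] towards [a] would hit the boundary of [I] inside the segment;
   for [m >= 1] the point [b] itself would lie in [I]. *)
have [m1|m1] := ltP m 1.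
  have Ib : I (b + (1 - m) *: (a - b)).
    by move: Im; congr (I _); apply/rowP => i; rewrite !mxE; ring.
  have [|s [s0 sm bs]] := ray_hits_boundary oI cI _ nclIb Ib.
    by rewrite subr_gt0.
  suff : (open_segment a b `&` (boundary I `|` boundary J)) (b + s *: (a - b)).
    by rewrite abIJ.
  split; last by left.
  exists (1 - s); last by apply/rowP => i; rewrite !mxE; ring.
  by rewrite /= in_itv/= subr_gt0 gtrBl s0 andbT (lt_trans sm)// gtrBl.
exfalso; apply: nclIb; apply: subset_closure.
have cla : closure I (a + 0 *: (b - a)) by rewrite scale0r addr0.
have := open_convex_ray oI cI cla Im ltr01 m1.
by rewrite scale1r addrC subrK.
Qed.

(** The ends are the boundary points hit from [p] in the two directions. A further boundary point
    between them would, by [open_convex_ray], put an end into the open set. A hyperplane containing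
    the segment contains the whole line, which has points of [I] and of [J], so it supports
    neither. *)
Lemma line_admissible I J p v T1 T2 : convex_pair I J ->
  ~ closure I p -> ~ closure J p -> 0 < T1 -> 0 < T2 ->
  I (p - T1 *: v) -> J (p + T2 *: v) ->
  exists s1 s2, [/\ 0 < s1, 0 < s2 & admissible I J (p - s1 *: v) (p + s2 *: v)].
Proof.
move=> IJ nIp nJp T10 T20 IT JT.
have [_ [oI oJ] [cI cJ] _] := IJ.
have {}IT : I (p + T1 *: (- v)) by rewrite scalerN.
have [s1 [s10 sT1 bI]] := ray_hits_boundary oI cI T10 nIp IT.
have [s2 [s20 sT2 bJ]] := ray_hits_boundary oJ cJ T20 nJp JT.
have bI' := bI; rewrite scalerN in bI'.
exists s1, s2; split => //; split => //.
- rewrite -subset0 => _ [[t t01 <-]]; have /andP[t0 t1] : 0 < t < 1 by [].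
  have -> : (1 - t) *: (p - s1 *: v) + t *: (p + s2 *: v) =
      p + (t * s2 - (1 - t) * s1) *: v.
    by apply/rowP => i; rewrite !mxE; ring.
  set r := t * s2 - _ => -[[clI _]|[clJ _]].
    have clI' : closure I (p + (- r) *: (- v)) by rewrite scalerN scaleNr opprK.
    have rs : - r < s1 by rewrite /r; nra.
    have [_] := (boundary_openE _ oI).1 bI; apply.
    exact: (open_convex_ray oI cI clI' IT rs (ltW sT1)).
  have rs : r < s2 by rewrite /r; nra.
  have [_] := (boundary_openE _ oJ).1 bJ; apply.
  exact: (open_convex_ray oJ cJ clJ JT rs (ltW sT2)).
- move=> u c [_ _ Iuc] /open_segment_hyperplane[].
  have := Iuc _ IT; rewrite /half_space/= scalerN !edotBr edotDr !edotZr.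
  by move: (edot u p) (edot u v) => P V; nra.
- move=> u c [_ _ Juc] /open_segment_hyperplane[].
  have := Juc _ JT; rewrite /half_space/= edotBr !edotDr !edotZr.
  by move: (edot u p) (edot u v) => P V; nra.
Qed.

Lemma dir_coneP A p v : dir_cone A p 0 v <-> exists2 l, 0 < l & A (p + l *: v).
Proof.
split; last by move=> [l l0 Al]; exists l, 0; rewrite scaler0 addr0.
by move=> [l [m []]]; rewrite scaler0 addr0; exists l.
Qed.

(** The segment prolonged beyond [b] enters [J], which gives the direction. If [p] were in the
    closure of [J], then [b], which lies between [p] and that point of [J], would be in [J]. *)
Lemma admissible_dir I J a b s p : convex_pair I J -> admissible I J a b ->
  s < 1 -> p = (1 - s) *: a + s *: b ->
  ~ closure J p /\ dir_cone J p 0 (b - a).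
Proof.
move=> IJ adm s1 pE; have [_ [_ oJ] [_ cJ] _] := IJ.
have [e e0 Je] := admissible_beyond (convex_pairC IJ) (admissibleC adm).
have {}Je : J (p + (1 - s + e) *: (b - a)).
  by move: Je; congr (J _); rewrite pE; apply/rowP => i; rewrite !mxE; ring.
split; last by apply/dir_coneP; exists (1 - s + e) => //; lra.
move=> clJ; have clJ0 : closure J (p + 0 *: (b - a)) by rewrite scale0r addr0.
have s1' : 0 < 1 - s by lra.
have se : 1 - s <= 1 - s + e by lra.
have := open_convex_ray oJ cJ clJ0 Je s1' se.
have -> : p + (1 - s) *: (b - a) = b.
  by rewrite pE; apply/rowP => i; rewrite !mxE; ring.
by have [_ Jb _ _ _] := adm; have [] := (boundary_openE b oJ).1 Jb.
Qed.

Lemma admissible_dirs I J a b s p : convex_pair I J -> admissible I J a b ->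
  0 < s < 1 -> p = (1 - s) *: a + s *: b ->
  [/\ ~ closure I p, ~ closure J p, dir_cone I p 0 (a - b) &
      dir_cone J p 0 (b - a)].
Proof.
move=> IJ adm /andP[s0 s1] pE.
have [nJ dJ] := admissible_dir IJ adm s1 pE.
have [||nI dI] := admissible_dir (s := 1 - s) (p := p) (convex_pairC IJ)
  (admissibleC adm).
- by rewrite gtrBl.
- by rewrite subKr addrC.
by split.
Qed.

Lemma Omega_dirs I J p : convex_pair I J -> Omega I J p ->
  [/\ ~ closure I p, ~ closure J p &
      exists v, dir_cone I p 0 (- v) /\ dir_cone J p 0 v].
Proof.
move=> IJ [a [b [adm [s]]]]; rewrite /= in_itv/= => s01 /esym pE.
have [nI nJ dI dJ] := admissible_dirs IJ adm s01 pE.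
by split => //; exists (b - a); rewrite opprB.
Qed.

Lemma dirs_admissible I J p v : convex_pair I J -> Omega I J p ->
  dir_cone I p 0 (- v) -> dir_cone J p 0 v ->
  exists s1 s2, [/\ 0 < s1, 0 < s2 & admissible I J (p - s1 *: v) (p + s2 *: v)].
Proof.
move=> IJ Op /dir_coneP[T1 T10 IT] /dir_coneP[T2 T20 JT].
have [nI nJ _] := Omega_dirs IJ Op.
by apply: (@line_admissible _ _ _ _ T1 T2) => //; rewrite -scalerN.
Qed.

Lemma dir_cone_neq0 A p v : ~ closure A p -> dir_cone A p 0 v -> v != 0.
Proof.
move=> nA /dir_coneP[l l0 Al]; apply: contra_notN nA => /eqP v0.
by apply: subset_closure; move: Al; rewrite v0 scaler0 addr0.
Qed.

(** Apart from [0], the cone of the partial order is the intersection of two open convex cones with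
    apex the origin, spanned by [J - p] and by [p - I]; openness and convexity are read off from
    this form. *)
Lemma cone_atP I J p v : convex_pair I J -> Omega I J p ->
  cone_at I J p v <-> v = 0 \/ dir_cone I p 0 (- v) /\ dir_cone J p 0 v.
Proof.
move=> IJ Op; have [nI nJ _] := Omega_dirs IJ Op; split.
  move=> [->|[v0 [t [t0 _]]]]; first by left.
  move=> [a [b [adm [s [s' [s0 ss' s'1 pE qE]]]]]]; right.
  have s01 : 0 < s < 1 by rewrite s0 (lt_trans ss').
  have [_ _ dI dJ] := admissible_dirs IJ adm s01 pE.
  have k0 : 0 < (s' - s) / t by rewrite divr_gt0// subr_gt0.
  have vE : v = ((s' - s) / t) *: (b - a).
    apply: (@scalerI _ _ t); first by rewrite gt_eqF.
    rewrite scalerA mulrC divfK ?gt_eqF//.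
    have -> : t *: v = p + t *: v - p by rewrite addrAC subrr add0r.
    by rewrite qE pE; apply/rowP => i; rewrite !mxE; ring.
  rewrite vE -scalerN opprB.
  by split; exact: dir_coneZ.
move=> [->|[dI dJ]]; first by left.
right; split; first exact: dir_cone_neq0 dJ.
have [s1 [s2 [s10 s20 adm]]] := dirs_admissible IJ Op dI dJ.
have s0 : 0 < s1 + s2 by rewrite addr_gt0.
have h0 : 0 < s2 / 2 by rewrite divr_gt0.
have ss : (s1 + s2 / 2) / (s1 + s2) < 1.
  by rewrite ltr_pdivrMr// mul1r ltrD2l ltr_pdivrMr// ltr_pMr// ltr1n.
(* Half of [s2] gives a point strictly between [p] and the end on [J]. *)
exists (s2 / 2); split => //.
  exists (p - s1 *: v), (p + s2 *: v); split => //.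
  exists ((s1 + s2 / 2) / (s1 + s2)); last by rewrite -line_param.
  by rewrite /= in_itv/= ss divr_gt0// addr_gt0.
exists (p - s1 *: v), (p + s2 *: v); split => //.
exists (s1 / (s1 + s2)), ((s1 + s2 / 2) / (s1 + s2)); split => //.
- by rewrite divr_gt0.
- by rewrite ltr_pM2r ?invr_gt0// ltrDl.
- by have := line_param p v 0 s0; rewrite scale0r !addr0.
- exact: line_param.
Qed.

Lemma sub_hull I J : J `<=` hull I J.
Proof. by move=> x Jx u c [_ _ Juc] _; exact: Juc. Qed.

(** The value [s^-1] is attained because the hull contains [J]. A supporting hyperplane at the
    visible point [p + s *: v] also bounds the hull, and the point of [J] at [T > s] shows that [u]
    strictly decreases along [v]; so the closed hull is not reached before [s]. *)
Lemma funk_functionalE I J p v s T : J !=set0 -> open J -> convex_set J ->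
  visible I J (p + s *: v) -> 0 < s -> s < T -> J (p + T *: v) ->
  funk_functional I J p v = s^-1.
Proof.
move=> J0 oJ cJ vis s0 sT JT; have [Jb _] := vis.
have [clJ nJ] := (boundary_openE _ oJ).1 Jb.
have v0 : v != 0.
  by apply: contra_notN nJ => /eqP v0; move: JT; rewrite v0 !scaler0.
have [u sup_u] := supporting_exists J0 oJ cJ Jb.
rewrite /funk_functional (negbTE v0).
set E := [set tau | _].
have Es : E s^-1.
  split; first by rewrite invr_gt0.
  by rewrite invrK; apply: closureS clJ; exact: sub_hull.
have ubE : ubound E s^-1.
  move=> tau [tau0 cl].
  have hullu : hull I J `<=` half_space u (edot u (p + s *: v)).
    by move=> x; apply => //; exists (p + s *: v).
  have := closure_supporting hullu cl.
  have [_ _ Ju] := sup_u; have := Ju _ JT.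
  rewrite /half_space/= !edotDr !edotZr ltrD2l lerD2l => uT ut.
  have uv : edot u v < 0 by nra.
  move: ut; rewrite ler_nM2r// => ut.
  by rewrite -(invrK tau) lef_pV2 ?posrE ?invr_gt0.
apply/eqP; rewrite eq_le; apply/andP; split; first by apply: ge_sup => //; exists s^-1.
by apply: ub_le_sup => //; exists s^-1.
Qed.

Lemma funk_functional_admissible I J p v s1 s2 : convex_pair I J ->
  admissible I J (p - s1 *: v) (p + s2 *: v) -> 0 < s1 -> 0 < s2 ->
  funk_functional I J p v = s2^-1.
Proof.
move=> IJ adm s10 s20.
have [[_ J0] [_ oJ] [_ cJ] _] := IJ.
have [e e0 Je] := admissible_beyond (convex_pairC IJ) (admissibleC adm).
(* The segment has direction [(s1 + s2) *: v], so going beyond its end by the fraction [e] adds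
   [e * (s1 + s2)] to the parameter. *)
apply: (@funk_functionalE _ _ _ _ _ (s2 + e * (s1 + s2))) => //.
- exact: admissible_visible adm.
- by rewrite ltrDl mulr_gt0// addr_gt0.
- by move: Je; congr (J _); apply/rowP => i; rewrite !mxE; ring.
Qed.

Lemma f_H_admissible I J p v s1 s2 : convex_pair I J ->
  admissible I J (p - s1 *: v) (p + s2 *: v) -> 0 < s1 -> 0 < s2 ->
  f_H I J p v = 2^-1 * (s2^-1 + s1^-1).
Proof.
move=> IJ adm s10 s20; rewrite /f_H (funk_functional_admissible IJ adm)//.
rewrite (@funk_functional_admissible J I p (- v) s2 s1)//; first exact: convex_pairC.
by rewrite !scalerN opprK; exact: admissibleC.
Qed.

(** The right-hand side is the reciprocal of the parameter at which the ray crosses the hyperplane,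
    and it must cross no later than it reaches the closure of [J]. *)
Lemma supporting_hit_le J u c p v s : supporting J u c -> c < edot u p -> 0 < s ->
  closure J (p + s *: v) -> s^-1 <= - edot u v / (edot u p - c).
Proof.
move=> [_ _ Juc] cup s0 clJ; have := closure_supporting Juc clJ.
rewrite edotDr edotZr => us.
rewrite ler_pdivlMr ?subr_gt0// ler_pdivrMl//.
by lra.
Qed.

Lemma supporting_hit_eq u p v s : 0 < s -> edot u (p + s *: v) < edot u p ->
  s^-1 = - edot u v / (edot u p - edot u (p + s *: v)).
Proof.
move=> s0; rewrite edotDr edotZr gtrDl pmulr_rlt0// => uv; field.
rewrite (gt_eqF s0) andbT opprD addrA subrr sub0r oppr_eq0.
by rewrite mulf_eq0 (gt_eqF s0) (lt_eqF uv).
Qed.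

End Omega.

(** * The Minkowski functional on the cone at a point *)

Section FinslerStructure.
Context {R : realType} {n : nat}.
Implicit Types (I J : set 'rV[R]_n) (p u v x y : 'rV[R]_n) (s t c : R).

Lemma cone_at_setD0 I J p : convex_pair I J -> Omega I J p ->
  cone_at I J p `\` [set 0] =
  [set v | dir_cone I p 0 (- v) /\ dir_cone J p 0 v].
Proof.
move=> IJ Op; have [nI nJ _] := Omega_dirs IJ Op.
apply/seteqP; split => v /=.
  by move=> [/(cone_atP _ IJ Op)[->|]].
move=> dv; split; first by apply/(cone_atP _ IJ Op); right.
by case: dv => _ /(dir_cone_neq0 nJ)/eqP.
Qed.

Lemma proper_cone_at I J p : convex_pair I J -> Omega I J p ->
  proper_open_convex_cone (cone_at I J p `\` [set 0]).
Proof.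
move=> IJ Op; rewrite cone_at_setD0//.
have [nI nJ Cne] := Omega_dirs IJ Op.
have [[_ J0] [oI oJ] [cI cJ] _] := IJ.
split => //.
- have oN : open [set v | dir_cone I p 0 (- v)].
    rewrite (_ : mkset _ = [set v | dir_cone I p 0 (0 + (- 1) *: v)]).
      by apply: open_preimage_affine; exact: open_dir_cone.
    by apply/seteqP; split => v /=; rewrite scaleN1r add0r.
  exact: openI oN (open_dir_cone oJ).
- apply/convex_setW => x y /set_mem[Ix Jx] /set_mem[Iy Jy] k k0 k1.
  have k1' : 0 < 1 - k%:num by rewrite subr_gt0.
  apply/mem_set; split; rewrite /conv/= /unstable.onem.
    by rewrite opprD -!scalerN; apply: dir_coneD => //; exact: dir_coneZ.
  by apply: dir_coneD => //; exact: dir_coneZ.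
- by move=> l x l0 [Ix Jx]; split; rewrite -?scalerN; exact: dir_coneZ.
(* A hyperplane through [p] that misses [J] has the cone over [J] strictly on one side; translated
   to the origin, it shows properness. *)
have [|u [_ uJ]] := @open_convex_separation _ _ J p 0 J0 oJ cJ.
  by move=> m; rewrite scaler0 addr0 => /(@subset_closure _ J).
have uC v : dir_cone J p 0 v -> 0 < edot (- u) v.
  move=> /dir_coneP[l l0 /uJ].
  by rewrite edotDr edotZr gtrDl pmulr_rlt0// edotNl oppr_gt0.
exists (- u); split.
- rewrite oppr_eq0; case: J0 => x /uJ; apply: contraTneq => ->.
  by rewrite !(edotC 0) !edot0r ltxx.
- by move=> v [_ /uC/ltW].
- apply/seteqP; split => [v [+ [[_ /uC]|//]]|v ->].
    by rewrite /hyperplane/= => ->; rewrite ltxx.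
  by split; [exact: edot0r|right].
Qed.

(** The hyperplane supporting [J] at the end of the ray along [z] gives a linear function of the
    direction that bounds the functional from above at [x] and [y] and equals it at [z]. *)
Lemma funk_functional_concave I J p x y t : convex_pair I J -> Omega I J p ->
  dir_cone I p 0 (- x) -> dir_cone J p 0 x ->
  dir_cone I p 0 (- y) -> dir_cone J p 0 y -> 0 < t -> t < 1 ->
  (1 - t) * funk_functional I J p x + t * funk_functional I J p y <=
  funk_functional I J p ((1 - t) *: x + t *: y).
Proof.
move=> IJ Op Ix Jx Iy Jy t0 t1; set z := (1 - t) *: x + t *: y.
have [[_ J0] [oI oJ] [cI cJ] _] := IJ.
have t1' : 0 < 1 - t by rewrite subr_gt0.
have Iz : dir_cone I p 0 (- z).
  by rewrite opprD -!scalerN; apply: dir_coneD => //; exact: dir_coneZ.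
have Jz : dir_cone J p 0 z by apply: dir_coneD => //; exact: dir_coneZ.
have [r1 [r2 [r10 r20 admx]]] := dirs_admissible IJ Op Ix Jx.
have [q1 [q2 [q10 q20 admy]]] := dirs_admissible IJ Op Iy Jy.
have [s1 [s2 [s10 s20 admz]]] := dirs_admissible IJ Op Iz Jz.
rewrite !(funk_functional_admissible IJ admx, funk_functional_admissible IJ admy,
  funk_functional_admissible IJ admz)//.
have [_ bx _ _ _] := admx; have [_ by_ _ _ _] := admy.
have [_ bz _ _ _] := admz.
have [u su] := supporting_exists J0 oJ cJ bz.
have [e e0 Je] := admissible_beyond (convex_pairC IJ) (admissibleC admz).
have uz : edot u (p + s2 *: z) < edot u p.
  have [_ _ Ju] := su; have := Ju _ Je; rewrite /half_space/=.
  rewrite [X in edot u X < _](_ : _ = p + s2 *: z + (e * (s1 + s2)) *: z); last first.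
    by apply/rowP => i; rewrite !mxE; ring.
  rewrite edotDr edotZr gtrDl pmulr_rlt0; last by rewrite mulr_gt0// addr_gt0.
  by move=> uz; rewrite edotDr edotZr gtrDl pmulr_rlt0.
have [clx _] := bx; have [cly _] := by_.
have hx := supporting_hit_le su uz r20 clx.
have hy := supporting_hit_le su uz q20 cly.
rewrite (supporting_hit_eq s20 uz).
have -> : edot u z = (1 - t) * edot u x + t * edot u y.
  by rewrite edotDr !edotZr.
apply: (@le_trans _ _ ((1 - t) * (- edot u x / (edot u p - edot u (p + s2 *: z))) +
    t * (- edot u y / (edot u p - edot u (p + s2 *: z))))).
  by rewrite lerD// ler_pM2l.
by rewrite !mulrA -mulrDl !mulrN -opprD.
Qed.

Lemma f_H_gt0 I J p v : convex_pair I J -> Omega I J p ->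
  dir_cone I p 0 (- v) -> dir_cone J p 0 v -> 0 < f_H I J p v.
Proof.
move=> IJ Op Iv Jv; have [s1 [s2 [s10 s20 adm]]] := dirs_admissible IJ Op Iv Jv.
by rewrite (f_H_admissible IJ adm)// mulr_gt0 ?addr_gt0 ?invr_gt0.
Qed.

Lemma f_HZ I J p v l : convex_pair I J -> Omega I J p ->
  dir_cone I p 0 (- v) -> dir_cone J p 0 v -> 0 < l ->
  f_H I J p (l *: v) = l * f_H I J p v.
Proof.
move=> IJ Op Iv Jv l0.
have [s1 [s2 [s10 s20 adm]]] := dirs_admissible IJ Op Iv Jv.
rewrite (f_H_admissible IJ adm)//.
rewrite (@f_H_admissible _ _ I J p (l *: v) (s1 / l) (s2 / l)) ?divr_gt0//.
  by field; rewrite !gt_eqF.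
by rewrite !scalerA !divfK ?gt_eqF.
Qed.

Lemma f_H_0 I J p : f_H I J p 0 = 0.
Proof. by rewrite /f_H /funk_functional oppr0 eqxx addr0 mulr0. Qed.

Lemma f_H_Minkowski I J p : convex_pair I J -> Omega I J p ->
  timelike_Minkowski_functional (cone_at I J p `\` [set 0]) (f_H I J p).
Proof.
move=> IJ Op; split; first exact: proper_cone_at.
- exact: f_H_0.
- by rewrite cone_at_setD0// => v [Iv Jv]; exact: f_H_gt0.
- by rewrite cone_at_setD0// => v l [Iv Jv]; exact: f_HZ.
- rewrite cone_at_setD0// => x y t [Ix Jx] [Iy Jy] t0 t1.
  have JI := convex_pairC IJ.
  rewrite mulrCA [t * _]mulrCA -mulrDr ler_pM2l ?invr_gt0//.
  rewrite !mulrDr addrACA lerD//; first exact: funk_functional_concave.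
  rewrite opprD -!scalerN; apply: funk_functional_concave; rewrite ?opprK//.
  by rewrite OmegaC.
Qed.

End FinslerStructure.

(** * Integrating a derivative along a piecewise curve *)

Section LowerIntegral.
Import HBNNSimple.
Local Open Scope ereal_scope.

(* The integrand need not be measurable: its integral is the supremum of those
   of the measurable functions below it. *)
Lemma le_integral_of_measurable d (T : measurableType d) (R : realType)
    (mu : {measure set T -> \bar R}) (D : set T) (f : T -> R) (M : \bar R) :
  measurable D -> (forall x, D x -> (0 <= f x)%R) ->
  (forall h : T -> R, measurable_fun setT h -> (forall x, (0 <= h x)%R) ->
    (forall x, D x -> (h x <= f x)%R) -> \int[mu]_(x in D) (h x)%:E <= M) ->
  \int[mu]_(x in D) (f x)%:E <= M.
Proof.
move=> mD f0 leM; rewrite ge0_integralE//.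
apply: ge_ereal_sup => _ [h hf <-].
have hf' x : D x -> (h x <= f x)%R.
  by move=> Dx; have := hf x; rewrite patchE mem_set.
have hD : EFin \o h = (EFin \o h) \_ D.
  apply/funext => x; rewrite patchE; case: ifPn => // /negP nDx.
  apply/eqP; rewrite eq_le; apply/andP; split; last by rewrite lee_fin fun_ge0.
  by have := hf x; rewrite patchE; case: ifPn.
rewrite -integralT_nnsfun [X in integral _ _ X]hD -integral_mkcond.
by apply: leM.
Qed.

End LowerIntegral.

(** * From one-sided difference quotients to limits and derivatives *)

Section OneSidedDerivatives.
Context {R : realType}.
Implicit Types (k d : R -> R) (a b t l : R).

Lemma cvg_at_right_shift (U : topologicalType) (f : R -> U) t (l : U) :
  f (t + h) @[h --> 0^'+] --> l -> f @ t^'+ --> l.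
Proof.
move=> fl V /fl [e /= e0 eV]; exists e => //= z zt tz.
have := eV (z - t); rewrite /= sub0r normrN subr_gt0 (addrC t) subrK distrC.
exact.
Qed.

Lemma cvg_at_left_shift (U : topologicalType) (f : R -> U) t (l : U) :
  f (t + h) @[h --> 0^'-] --> l -> f @ t^'- --> l.
Proof.
move=> fl V /fl [e /= e0 eV]; exists e => //= z zt tz.
have := eV (z - t); rewrite /= sub0r normrN subr_lt0 (addrC t) subrK distrC.
exact.
Qed.

Lemma cvg_of_quotient k t (F : set_system R) {FF : Filter F} l :
  F --> (0 : R) -> (\forall h \near F, h != 0) ->
  h^-1 * (k (t + h) - k t) @[h --> F] --> l -> k (t + h) @[h --> F] --> k t.
Proof.
move=> F0 Fn0 kl.
have : k t + h * (h^-1 * (k (t + h) - k t)) @[h --> F] --> k t + 0 * l.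
  apply: (@cvgD _ _ _ F FF (fun=> k t)); first exact: cvg_cst.
  exact: (@cvgM _ _ F FF id).
rewrite mul0r addr0; apply: cvg_trans.
apply: near_eq_cvg; near=> h.
have h0 : h != 0 by near: h.
by rewrite mulrA divff// mul1r addrC subrK.
Unshelve. all: by end_near. Qed.

Lemma cvg_right_of_derivative k t l :
  h^-1 * (k (t + h) - k t) @[h --> 0^'+] --> l -> k @ t^'+ --> k t.
Proof.
move=> kl; apply: cvg_at_right_shift; apply: cvg_of_quotient kl.
  exact: cvg_within.
exact: nbhs_right_neq.
Qed.

Lemma cvg_left_of_derivative k t l :
  h^-1 * (k (t + h) - k t) @[h --> 0^'-] --> l -> k @ t^'- --> k t.
Proof.
move=> kl; apply: cvg_at_left_shift; apply: cvg_of_quotient kl.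
  exact: cvg_within.
exact: nbhs_left_neq.
Qed.

Lemma cvg_dnbhs_of_sides (U : topologicalType) (f : R -> U) (l : U) :
  f h @[h --> 0^'+] --> l -> f h @[h --> 0^'-] --> l -> f h @[h --> 0^'] --> l.
Proof.
move=> fr fl V Vl; have [e /= e0 eV] := fr _ Vl; have [d /= d0 dV] := fl _ Vl.
exists (Num.min e d); first by rewrite /= lt_min e0.
move=> z /=; rewrite lt_min => /andP[ze zd].
by rewrite neq_lt => /orP[z0|z0]; [exact: dV|exact: eV].
Qed.

Lemma derive1_of_sides k t l :
  h^-1 * (k (t + h) - k t) @[h --> 0^'+] --> l ->
  h^-1 * (k (t + h) - k t) @[h --> 0^'-] --> l ->
  derivable k t 1 /\ derive1 k t = l.
Proof.
move=> kr kl; have kq := cvg_dnbhs_of_sides kr kl.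
have kq' : h^-1 *: (k (h *: 1 + t) - k t) @[h --> 0^'] --> l.
  by apply: cvg_trans kq; apply: near_eq_cvg; near=> h;
    rewrite /= [_%:A]mulr1 (addrC t).
split; first by apply/cvg_ex; exists l.
by rewrite derive1E; exact: (cvg_lim _ kq').
Unshelve. all: by end_near. Qed.

Lemma vector_derive1_of_sides n (sigma : R -> 'rV[R]_n) t v :
  right_derivative sigma t v -> left_derivative sigma t v ->
  derive1 sigma t = v.
Proof.
move=> kr kl; have kq := cvg_dnbhs_of_sides kr kl.
rewrite /derive1; apply: cvg_lim => //.
by apply: cvg_trans kq; apply: near_eq_cvg; near=> h; rewrite (addrC t).
Unshelve. all: by end_near. Qed.

End OneSidedDerivatives.

(** * Propagation of positivity when the sign of the derivative is known only where the function is
    positive *)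

Section Positivity.
Context {R : realType}.
Implicit Types (k d : R -> R) (a b t l : R).

(** Compactness provides a first and a last time at which [k] fails to be positive. *)
Lemma compact_nonpos k a b : {within `[a, b], continuous k} ->
  compact (`[a, b] `&` [set t | k t <= 0]).
Proof.
move=> /subspace_continuousP ck.
apply: (subclosed_compact _ (@segment_compact _ a b)); last exact: subIsetl.
apply/closure_id/seteqP; split; first exact: subset_closure.
move=> t clt; have tab : `[a, b]%classic t.
  have cab : closed (`[a, b]%classic : set R) by exact: itv_closed.
  rewrite ((closure_id _).1 cab).
  by apply: closureS clt; exact: subIsetl.
split => //; rewrite /= leNgt; apply/negP => kt.
have pos : \forall s \near within `[a, b] (nbhs t), 0 < k s.
  exact: (cvgr_gt _ (ck _ tab) _ kt).
have [s [[sab ks] /(_ sab)]] := clt _ pos.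
by rewrite ltNge ks.
Qed.

(** Let [m] be the first time with [k m <= 0]. Before [m] the function is positive, hence
    nondecreasing, so [k a <= k m], a contradiction. The backward version uses the last such
    time. *)
Lemma pos_forward k a b : derivable_oo_LRcontinuous k a b -> 0 < k a ->
  {in `]a, b[, forall t, 0 < k t -> 0 <= derive1 k t} ->
  {in `[a, b], forall t, 0 < k t}.
Proof.
move=> dk ka k'0 t tab; rewrite ltNge; apply/negP => kt.
have ck := derivable_oo_LRcontinuous_within dk.
have [||m] := @compact_EVT_min _ R id _ _ (compact_nonpos ck).
  by exists t; split.
  by apply: continuous_subspaceT => s; exact: cvg_id.
move=> /set_mem[/= mab km] mmin.
have /andP[am mb] : a <= m <= b by [].
have am' : a < m.
  by rewrite lt_neqAle am andbT; apply: contraTneq km => <-; rewrite -ltNge.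
have kpos s : s \in `]a, m[ -> 0 < k s.
  rewrite in_itv/= => /andP[as_ sm]; rewrite ltNge; apply/negP => ks.
  suff : m <= s by rewrite leNgt sm.
  by apply/mmin/mem_set; split => //=; rewrite in_itv/= ltW//= (le_trans (ltW sm)).
have sab s : s \in `]a, m[ -> s \in `]a, b[.
  by rewrite !in_itv/= => /andP[-> sm]; rewrite (lt_le_trans sm).
have : k a <= k m.
  apply: (@ger0_derive1_ndecr _ k a m) => //.
  - by move=> s /sab; case: dk => + _ _; exact.
  - by move=> s sam; apply: k'0; [exact: sab|exact: kpos].
  - apply: continuous_subspaceW ck => s /=; rewrite !in_itv/= => /andP[-> sm].
    exact: le_trans sm mb.
by rewrite leNgt (le_lt_trans km).
Qed.

Lemma pos_backward k a b : derivable_oo_LRcontinuous k a b -> 0 < k b ->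
  {in `]a, b[, forall t, 0 < k t -> derive1 k t <= 0} ->
  {in `[a, b], forall t, 0 < k t}.
Proof.
move=> dk kb k'0 t tab; rewrite ltNge; apply/negP => kt.
have ck := derivable_oo_LRcontinuous_within dk.
have [||m] := @compact_EVT_max _ R id _ _ (compact_nonpos ck).
  by exists t; split.
  by apply: continuous_subspaceT => s; exact: cvg_id.
move=> /set_mem[/= mab km] mmax.
have /andP[am mb] : a <= m <= b by [].
have mb' : m < b.
  by rewrite lt_neqAle mb andbT; apply: contraTneq km => ->; rewrite -ltNge.
have kpos s : s \in `]m, b[ -> 0 < k s.
  rewrite in_itv/= => /andP[ms sb]; rewrite ltNge; apply/negP => ks.
  suff : s <= m by rewrite leNgt ms.
  by apply/mmax/mem_set; split => //=; rewrite in_itv/= (ltW sb) (le_trans am)// ltW.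
have sab s : s \in `]m, b[ -> s \in `]a, b[.
  by rewrite !in_itv/= => /andP[ms ->]; rewrite (le_lt_trans am).
have : k b <= k m.
  apply: (@ler0_derive1_nincr _ k m b) => //.
  - by move=> s /sab; case: dk => + _ _; exact.
  - by move=> s sam; apply: k'0; [exact: sab|exact: kpos].
  - apply: continuous_subspaceW ck => s /=; rewrite !in_itv/= => /andP[ms ->].
    by rewrite (le_trans am ms).
by rewrite leNgt (le_lt_trans km).
Qed.

End Positivity.

(** * Bounding integrals by increments of a primitive *)

Section PiecewiseIntegral.
Context {R : realType}.
Notation mu := (@lebesgue_measure R).
Implicit Types (F phi f h : R -> R) (a b t x y : R) (s : seq R).

Definition primitive_on F phi a b : Prop :=
  [/\ {within `[a, b], continuous phi}, derivable_oo_LRcontinuous F a b &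
      {in `]a, b[, derive1 F =1 phi}].

Lemma le_integral_primitive h F phi a b : a < b ->
  measurable_fun setT h -> (forall t, 0 <= h t) -> primitive_on F phi a b ->
  {in `]a, b[, forall t, h t <= phi t} ->
  (\int[mu]_(t in `[a, b]) (h t)%:E <= (F b - F a)%:E)%E.
Proof.
move=> ab mh h0 [cphi dF dFphi] hphi.
rewrite EFinB -(continuous_FTC2 ab cphi dF dFphi).
have mphi : measurable_fun `]a, b[ phi.
  apply: (@measurable_funS _ _ _ _ `[a, b]) => //.
    by apply: subset_itvW.
  exact: subspace_continuous_measurable_fun.
(* The bound [h t <= phi t] is given only inside the interval, so both integrals are moved to the
   open interval. *)
rewrite integral_itv_bndoo; last first.
  by apply/measurable_EFinP; exact: measurable_funTS.
rewrite [leRHS]integral_itv_bndoo; last exact/measurable_EFinP.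
apply: ge0_le_integral => //.
- by move=> t _; rewrite lee_fin.
- by apply/measurable_EFinP; exact: measurable_funTS.
- by apply/measurable_EFinP.
Qed.

Lemma integral_itv_cat h a x b : a <= x -> x <= b ->
  measurable_fun setT h -> (forall t, 0 <= h t) ->
  (\int[mu]_(t in `[a, b]) (h t)%:E =
   \int[mu]_(t in `[a, x]) (h t)%:E + \int[mu]_(t in `[x, b]) (h t)%:E)%E.
Proof.
move=> ax xb mh h0.
have mhE D : measurable_fun D (EFin \o h).
  by apply/measurable_EFinP; exact: measurable_funTS.
rewrite (@itv_bndbnd_setU _ _ (BLeft a) (BRight x) (BRight b)) ?bnd_simp//.
rewrite ge0_integral_setU//=.
- by rewrite integral_itv_obnd_cbnd.
- exact: mhE.
- by move=> t _; rewrite lee_fin.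
- apply/disj_set2P/seteqP; split => // t [/=]; rewrite !in_itv/=.
  by move=> /andP[_ tx] /andP[+ _]; rewrite ltNge tx.
Qed.

(** For a measurable minorant [h] of [f] the integral splits over the pieces, and the increments of
    the common function [F] telescope. *)
Lemma le_integral_piecewise f F s a b : itv_partition a b s ->
  (forall t, 0 <= f t) ->
  (forall i, (i < size s)%N -> exists2 phi,
    primitive_on F phi (nth 0 (a :: s) i) (nth 0 s i) &
    {in `]nth 0 (a :: s) i, nth 0 s i[, forall t, f t <= phi t}) ->
  (\int[mu]_(t in `[a, b]) (f t)%:E <= (F b - F a)%:E)%E.
Proof.
move=> pab f0 fF; apply: le_integral_of_measurable => //.
move=> h mh h0 hf; elim: s a pab fF hf => [|x s IH] a pab fF hf.
  by rewrite (itv_partition_nil pab) subrr set_itv1 integral_set1.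
have [/= /andP[ax _] _] := pab.
have pxb := itv_partition_cons pab; have xb := itv_partition_le pxb.
rewrite (integral_itv_cat (ltW ax) xb mh h0).
have -> : (F b - F a)%:E = ((F x - F a)%:E + (F b - F x)%:E)%E.
  by rewrite -EFinD; congr EFin; ring.
apply: leeD.
  have [phi /= pphi fphi] := fF 0%N isT.
  apply: (le_integral_primitive ax mh h0 pphi) => t tax.
  apply: le_trans (fphi _ tax); apply: hf; move: tax; rewrite /= !in_itv/=.
  by move=> /andP[/ltW -> /ltW tx]; exact: le_trans xb.
apply: IH => //.
  by move=> i is_; exact: (fF i.+1).
move=> t; rewrite /= !in_itv/= => /andP[xt tb]; apply: hf.
by rewrite /= in_itv/= tb (le_trans (ltW ax)).
Qed.

Lemma primitive_half_ln_ratio (k1 k2 d1 d2 : R -> R) a b : a < b ->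
  primitive_on k1 d1 a b -> primitive_on k2 d2 a b ->
  {in `[a, b], forall t, 0 < k1 t} -> {in `[a, b], forall t, 0 < k2 t} ->
  primitive_on (fun t => 2^-1 * (ln (k2 t) - ln (k1 t)))
    (fun t => 2^-1 * (d2 t / k2 t - d1 t / k1 t)) a b.
Proof.
move=> ab [cd1 dk1 d1E] [cd2 dk2 d2E] k10 k20.
have ck1 := derivable_oo_LRcontinuous_within dk1.
have ck2 := derivable_oo_LRcontinuous_within dk2.
have cdiv (d k : R -> R) : {within `[a, b], continuous d} -> {within `[a, b], continuous k} ->
    {in `[a, b], forall t, 0 < k t} ->
    {within `[a, b], continuous (fun t => d t / k t)}.
  move=> /subspace_continuousP cd /subspace_continuousP ck k0.
  apply/subspace_continuousP => t tab; apply: cvgM; first exact: cd.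
  by apply: cvgV; [rewrite gt_eqF// k0|exact: ck].
have aab : a \in `[a, b] by rewrite in_itv/= lexx ltW.
have bab : b \in `[a, b] by rewrite in_itv/= lexx ltW.
have sub t : t \in `]a, b[ -> t \in `[a, b].
  by rewrite !in_itv/= => /andP[/ltW -> /ltW ->].
have isd (k d : R -> R) t : derivable_oo_LRcontinuous k a b -> {in `]a, b[, derive1 k =1 d} ->
    {in `[a, b], forall t, 0 < k t} -> t \in `]a, b[ ->
    is_derive t (1 : R) (fun t => ln (k t)) (d t / k t).
  move=> [dk _ _] dE k0 tab.
  have isk : is_derive t (1 : R) k (d t).
    by apply: DeriveDef; [exact: dk|rewrite -derive1E dE].
  have := is_derive1_comp (is_derive1_ln (k0 _ (sub _ tab))) isk.
  by rewrite mulrC.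
split.
- have c1 := cdiv _ _ cd1 ck1 k10; have c2 := cdiv _ _ cd2 ck2 k20.
  move/subspace_continuousP : c1 => c1; move/subspace_continuousP : c2 => c2.
  apply/subspace_continuousP => t tab.
  by apply: cvgM; [exact: cvg_cst|apply: cvgB; [exact: c2|exact: c1]].
- split.
  + move=> t tab; have i1 := isd _ _ _ dk1 d1E k10 tab.
    have i2 := isd _ _ _ dk2 d2E k20 tab.
    by apply: derivableM => //; apply: derivableB; apply: ex_derive.
  + case: dk1 dk2 => _ k1a _ [_ k2a _].
    apply: cvgM; [exact: cvg_cst|apply: cvgB].
      by apply: continuous_cvg k2a; apply: continuous_ln; exact: k20.
    by apply: continuous_cvg k1a; apply: continuous_ln; exact: k10.
  + case: dk1 dk2 => _ _ k1b [_ _ k2b].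
    apply: cvgM; [exact: cvg_cst|apply: cvgB].
      by apply: continuous_cvg k2b; apply: continuous_ln; exact: k20.
    by apply: continuous_cvg k1b; apply: continuous_ln; exact: k10.
- move=> t tab; have i1 := isd _ _ _ dk1 d1E k10 tab.
  have i2 := isd _ _ _ dk2 d2E k20 tab.
  rewrite derive1E; apply: derive_val.
Qed.

End PiecewiseIntegral.

(** * Lengths of timelike curves *)

Section Curves.
Context {R : realType} {n : nat}.
Implicit Types (I J : set 'rV[R]_n) (p q u v w x : 'rV[R]_n) (a b c d s t : R).
Implicit Types (sigma g : R -> 'rV[R]_n).

(** Stated for every [v], since the integrand is also evaluated at the dummy derivatives at break
    points. *)
Lemma funk_functional_ge0 I J p v : 0 <= funk_functional I J p v.
Proof.
rewrite /funk_functional; case: ifP => // _; set E := [set tau | _].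
(* For an empty or unbounded set [sup] takes the default value [0]. *)
have [supE|/sup_out -> //] := pselect (has_sup E).
have [[tau tauE] _] := supE; have [tau0 _] := tauE.
by rewrite (le_trans (ltW tau0))// ub_le_sup//; case: supE.
Qed.

Lemma f_H_ge0 I J p v : 0 <= f_H I J p v.
Proof. by rewrite mulr_ge0// addr_ge0// funk_functional_ge0. Qed.

(** A future direction leads to the closure of [J], hence towards every hyperplane that still
    separates [x] from [J]. This is the derivative sign used to propagate positivity along a
    curve. *)
Lemma cone_at_supporting_le0 I J u c x v : convex_pair I J -> Omega I J x ->
  cone_at I J x v -> supporting J u c -> c < edot u x -> edot u v <= 0.
Proof.
move=> IJ Ox /(cone_atP _ IJ Ox)[->|[Iv Jv]] su cux; first by rewrite edot0r.
have [s1 [s2 [s10 s20 adm]]] := dirs_admissible IJ Ox Iv Jv.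
have [_ [clb _] _ _ _] := adm.
have := supporting_hit_le su cux s20 clb.
rewrite ler_pdivlMr ?subr_gt0// => h.
rewrite -oppr_ge0; apply: le_trans h.
by rewrite mulr_ge0// ?invr_ge0 ?subr_ge0 ltW.
Qed.

Lemma cone_atN I J x v : convex_pair I J -> Omega I J x ->
  cone_at I J x v -> cone_at J I x (- v).
Proof.
move=> IJ Ox; have JI := convex_pairC IJ; have Ox' := Ox; rewrite OmegaC in Ox'.
move=> /(cone_atP _ IJ Ox)[->|[Iv Jv]]; apply/(cone_atP _ JI Ox').
  by left; rewrite oppr0.
by right; rewrite opprK.
Qed.

Lemma f_H_le I J u c w d x v : convex_pair I J -> Omega I J x ->
  cone_at I J x v -> supporting J u c -> c < edot u x ->
  supporting I w d -> d < edot w x ->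
  f_H I J x v <=
  2^-1 * (edot w v / (edot w x - d) - edot u v / (edot u x - c)).
Proof.
move=> IJ Ox /(cone_atP _ IJ Ox)[->|[Iv Jv]] su cux sw dwx.
  by rewrite f_H_0 !edot0r !mul0r subrr mulr0.
have [s1 [s2 [s10 s20 adm]]] := dirs_admissible IJ Ox Iv Jv.
have [[cla _] [clb _] _ _ _] := adm.
rewrite (f_H_admissible IJ adm)// ler_pM2l ?invr_gt0// addrC lerD//.
  rewrite -scalerN in cla.
  by have := supporting_hit_le sw dwx s10 cla; rewrite edotNr opprK.
by have := supporting_hit_le su cux s20 clb; rewrite mulNr.
Qed.

Lemma primitive_on_edot sigma g u c a b :
  {within `[a, b], continuous g} ->
  (forall t, a <= t < b -> right_derivative sigma t (g t)) ->
  (forall t, a < t <= b -> left_derivative sigma t (g t)) -> a < b ->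
  primitive_on (fun t => edot u (sigma t) - c) (fun t => edot u (g t)) a b.
Proof.
move=> cg rg lg ab; pose k t := edot u (sigma t) - c.
have kq t (F : set_system R) (FF : Filter F) v :
    h^-1 *: (sigma (t + h) - sigma t) @[h --> F] --> v ->
    h^-1 * (k (t + h) - k t) @[h --> F] --> edot u v.
  move=> sv; have := @cvg_edot _ _ _ F FF (fun=> u) _ _ _ (@cvg_cst _ u _ F FF) sv.
  apply: cvg_trans; apply: near_eq_cvg; near=> h.
  by rewrite /k edotZr edotBr; congr (_ * _); ring.
have rk t : a <= t < b -> h^-1 * (k (t + h) - k t) @[h --> 0^'+] --> edot u (g t).
  by move=> /rg; exact: kq.
have lk t : a < t <= b -> h^-1 * (k (t + h) - k t) @[h --> 0^'-] --> edot u (g t).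
  by move=> /lg; exact: kq.
have dk t : t \in `]a, b[ -> derivable k t 1 /\ derive1 k t = edot u (g t).
  rewrite in_itv/= => /andP[at_ tb]; apply: derive1_of_sides.
    by apply: rk; rewrite ltW.
  by apply: lk; rewrite at_ ltW.
split.
- move/subspace_continuousP : cg => cg; apply/subspace_continuousP => t tab.
  have FF := @within_filter _ `[a, b]%classic _ (nbhs_filter t).
  exact: (@cvg_edot _ _ _ _ FF (fun=> u) _ _ _ (@cvg_cst _ u _ _ FF) (cg _ tab)).
- split.
  + by move=> t /dk[].
  + by apply: cvg_right_of_derivative (rk _ _); rewrite lexx.
  + by apply: cvg_left_of_derivative (lk _ _); rewrite lexx andbT.
- by move=> t /dk[].
Unshelve. all: by end_near. Qed.

Lemma pos_piecewise_forward (k : R -> R) (s : seq R) a b :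
  itv_partition a b s -> 0 < k a ->
  (forall i, (i < size s)%N -> exists2 d,
    primitive_on k d (nth 0 (a :: s) i) (nth 0 s i) &
    {in `]nth 0 (a :: s) i, nth 0 s i[, forall t, 0 < k t -> 0 <= d t}) ->
  forall i, (i < size s)%N ->
    {in `[nth 0 (a :: s) i, nth 0 s i], forall t, 0 < k t}.
Proof.
elim: s a => // x s IH a pab ka kd.
have [/= /andP[ax _] _] := pab.
have kpos : {in `[a, x], forall t, 0 < k t}.
  have [d [_ dk dE] d0] := kd 0%N isT.
  by apply: (pos_forward dk ka) => t tax; rewrite dE//; exact: d0.
have kx : 0 < k x by apply: kpos; rewrite in_itv/= lexx ltW.
move=> [//|i] is_; apply: (IH x (itv_partition_cons pab) kx) => // j js.
exact: (kd j.+1).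
Qed.

(** Positivity at [a] is part of the conclusion because the induction hands it on to the preceding
    piece as its right end value. *)
Lemma pos_piecewise_backward (k : R -> R) (s : seq R) a b :
  itv_partition a b s -> 0 < k b ->
  (forall i, (i < size s)%N -> exists2 d,
    primitive_on k d (nth 0 (a :: s) i) (nth 0 s i) &
    {in `]nth 0 (a :: s) i, nth 0 s i[, forall t, 0 < k t -> d t <= 0}) ->
  0 < k a /\ forall i, (i < size s)%N ->
    {in `[nth 0 (a :: s) i, nth 0 s i], forall t, 0 < k t}.
Proof.
move=> + kb; elim: s a => [a /itv_partition_nil ->//|x s IH a pab kd].
have [/= /andP[ax _] _] := pab.
have [kx kpos] := IH x (itv_partition_cons pab) (fun j js => kd j.+1 js).
have kax : {in `[a, x], forall t, 0 < k t}.
  have [d [_ dk dE] d0] := kd 0%N isT.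
  by apply: (pos_backward dk kx) => t tax; rewrite dE//; exact: d0.
split; first by apply: kax; rewrite in_itv/= lexx ltW.
by move=> [//|i] is_; exact: kpos.
Qed.

Lemma curve_length_le I J sigma u c w d : convex_pair I J ->
  timelike_curve I J sigma -> supporting J u c -> c < edot u (sigma 1) ->
  supporting I w d -> d < edot w (sigma 0) ->
  (curve_length I J sigma <=
   (2^-1 * (ln (edot w (sigma 1) - d) - ln (edot u (sigma 1) - c)) -
    2^-1 * (ln (edot w (sigma 0) - d) - ln (edot u (sigma 0) - c)))%:E)%E.
Proof.
move=> IJ [[s s01 C1s] Os cr cl] su cu sw dw; have JI := convex_pairC IJ.
pose k1 t := edot u (sigma t) - c; pose k2 t := edot w (sigma t) - d.
pose x i := nth 0 (0 :: s) i; pose y i := nth 0 s i.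
have xy i : (i < size s)%N -> x i < y i.
  by have [/(pathP 0) + _] := s01; exact.
have xi0 i : (i < size s)%N -> 0 <= x i.
  (* The bounds for partitions take the right end [1] as default value of [nth]; for indices in
     range the default is immaterial. *)
  move=> is_; rewrite /x (set_nth_default 1) ?ltnS ?(ltnW is_)//.
  by apply: (itv_partition_nth_ge _ s01); rewrite ltnS ltnW.
have yi1 i : (i < size s)%N -> y i <= 1.
  move=> is_; rewrite /y (set_nth_default 1)//.
  (* [y i] is entry [i.+1] of [0 :: s]. *)
  exact: (itv_partition_nth_le (m := i.+1) is_ s01).
have t01 i t : (i < size s)%N -> t \in `]x i, y i[ -> 0 < t /\ t < 1.
  move=> is_; rewrite in_itv/= => /andP[xt ty].
  by rewrite (le_lt_trans (xi0 _ is_))// (lt_le_trans ty)// yi1.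
(* The quantifiers over [u] and [c] stand inside, so that one derivative [g] serves both
   hyperplanes. *)
have piece i : (i < size s)%N -> exists g, [/\
    forall u c, primitive_on (fun t => edot u (sigma t) - c)
      (fun t => edot u (g t)) (x i) (y i),
    {in `]x i, y i[, forall t, derive1 sigma t = g t} &
    {in `]x i, y i[, forall t, cone_at I J (sigma t) (g t)}].
  move=> is_; have [g [cg rg lg]] := C1s i is_; exists g.
  split=> [u' c'|t|t] => [||tab].
  - exact: primitive_on_edot (xy i is_).
  - rewrite in_itv/= => /andP[xt ty].
    apply: vector_derive1_of_sides; first by apply: rg; rewrite ltW.
    by apply: lg; rewrite xt ltW.
  - have [t0 t1] := t01 _ _ is_ tab.
    apply: cr; first by rewrite t1 ltW.
    by apply: rg; move: tab; rewrite in_itv/= => /andP[/ltW -> ->].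
have OsI i t : (i < size s)%N -> t \in `]x i, y i[ -> Omega I J (sigma t).
  by move=> is_ /(t01 _ _ is_)[t0 t1]; apply: Os; rewrite !ltW.
have k1pos : forall i, (i < size s)%N -> {in `[x i, y i], forall t, 0 < k1 t}.
  have k11 : 0 < k1 1 by rewrite subr_gt0.
  apply: (pos_piecewise_backward s01 k11 _).2 => i is_.
  have [g [pg _ cg]] := piece i is_; exists (fun t => edot u (g t)); first exact: pg.
  move=> t tab; rewrite subr_gt0 => kt.
  exact: (cone_at_supporting_le0 IJ (OsI _ _ is_ tab) (cg _ tab) su).
have k2pos : forall i, (i < size s)%N -> {in `[x i, y i], forall t, 0 < k2 t}.
  have k20 : 0 < k2 0 by rewrite subr_gt0.
  apply: (pos_piecewise_forward s01 k20) => i is_.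
  have [g [pg _ cg]] := piece i is_; exists (fun t => edot w (g t)); first exact: pg.
  move=> t tab; rewrite subr_gt0 => kt.
  (* The same sign argument with the two sets exchanged and the direction reversed. *)
  have Ot := OsI _ _ is_ tab; have Ot' := Ot; rewrite OmegaC in Ot'.
  have := cone_at_supporting_le0 JI Ot' (cone_atN IJ Ot (cg _ tab)) sw kt.
  by rewrite edotNr oppr_le0.
rewrite /curve_length.
apply: (@le_integral_piecewise _ _ (fun t => 2^-1 * (ln (k2 t) - ln (k1 t))) s) => //.
  by move=> t; exact: f_H_ge0.
move=> i is_; have [g [pg dg cg]] := piece i is_.
have k1i := k1pos _ is_; have k2i := k2pos _ is_.
exists (fun t => 2^-1 * (edot w (g t) / k2 t - edot u (g t) / k1 t)).
  exact: primitive_half_ln_ratio (xy _ is_) (pg _ _) (pg _ _) k1i k2i.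
move=> t tab; rewrite dg//.
have tab' : t \in `[x i, y i].
  by move: tab; rewrite !in_itv/= => /andP[/ltW -> /ltW ->].
apply: f_H_le => //.
- exact: OsI tab.
- exact: cg.
- by rewrite -subr_gt0; exact: k1i.
- by rewrite -subr_gt0; exact: k2i.
Qed.

End Curves.

(** * Length of straight segments and comparison with the Hilbert distance *)

Section Segments.
Context {R : realType} {n : nat}.
Implicit Types (I J : set 'rV[R]_n) (a b p q u v w : 'rV[R]_n) (s t D E : R).

Lemma H_formula I J p q : p != q -> precedes I J p q ->
  exists a b s t, [/\ admissible I J a b, 0 < s /\ s < t /\ t < 1,
    p = (1 - s) *: a + s *: b, q = (1 - t) *: a + t *: b &
    H I J p q = 2^-1 * (ln ((1 - s) / (1 - t)) + ln (t / s))].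
Proof.
move=> pq [a0 [b0 adm0]].
have : admissible_through I J p q (endpoints I J p q).1 (endpoints I J p q).2.
  rewrite /endpoints; case: xgetP => [[a b] _ //|/(_ (a0, b0))].
  by move=> /(_ adm0).
rewrite /H (negbTE pq) /F12 /F12bar.
case: (endpoints I J p q) => a b /= [adm [s [t [s0 st t1 pE qE]]]].
exists a, b, s, t; split => //.
have ab : a - b != 0.
  apply: contra_neq pq => /eqP; rewrite subr_eq0 => /eqP ab.
  by rewrite pE qE ab -!scalerDl !subrK.
have dist_gt0 v : v != 0 -> 0 < Defs.edist v 0.
  by move=> v0; rewrite sqrtr_gt0 subr0 edot_gt0.
have distb r : r <= 1 ->
    Defs.edist ((1 - r) *: a + r *: b) b = (1 - r) * Defs.edist (a - b) 0.
  move=> r1; rewrite -(edistZ (a - b) b) ?subr_ge0//; congr Defs.edist.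
  by apply/rowP => i; rewrite !mxE; ring.
have dista r : 0 <= r ->
    Defs.edist ((1 - r) *: a + r *: b) a = r * Defs.edist (b - a) 0.
  move=> r0; rewrite -(edistZ (b - a) a)//; congr Defs.edist.
  by apply/rowP => i; rewrite !mxE; ring.
have ba : b - a != 0 by rewrite -opprB oppr_eq0.
have s1 : s <= 1 by rewrite ltW// (lt_trans st).
have t0 : 0 <= t by rewrite ltW// (lt_trans s0).
rewrite pE qE !distb ?(ltW t1)// !dista ?(ltW s0)//.
have dab : Defs.edist (a - b) 0 != 0 by rewrite gt_eqF// dist_gt0.
have dba : Defs.edist (b - a) 0 != 0 by rewrite gt_eqF// dist_gt0.
by rewrite -!mulf_div (divff dab) (divff dba) !mulr1.
Qed.

(** The positive scales [D] and [E] cancel. They stand for the normalization of the two functionals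
    in the upper bound and for [(t - s)^-1] in the length of the segment. *)
Lemma half_ln_values s t D E : 0 < s -> s < t -> t < 1 -> 0 < D -> 0 < E ->
  2^-1 * (ln (t * E) - ln ((1 - t) * D)) - 2^-1 * (ln (s * E) - ln ((1 - s) * D)) =
  2^-1 * (ln ((1 - s) / (1 - t)) + ln (t / s)).
Proof.
move=> s0 st t1 D0 E0.
have t0 : 0 < t by rewrite (lt_trans s0).
have s1' : 0 < 1 - s by rewrite subr_gt0 (lt_trans st).
have t1' : 0 < 1 - t by rewrite subr_gt0.
by rewrite !lnM ?posrE ?invr_gt0// !lnV ?posrE//; ring.
Qed.

Lemma derivative_line p v t (F : set_system R) {FF : Filter F} :
  (\forall h \near F, h != 0) ->
  h^-1 *: ((p + (t + h) *: v) - (p + t *: v)) @[h --> F] --> v.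
Proof.
move=> F0; apply: cvg_trans (@cvg_cst _ v _ F FF); apply: near_eq_cvg; near=> h.
have h0 : h != 0 by near: h.
by apply/rowP => i; rewrite !mxE; field.
Unshelve. all: by end_near. Qed.

Lemma right_derivative_line p v t : right_derivative (fun r => p + r *: v) t v.
Proof. by apply: derivative_line; exact: nbhs_right_neq. Qed.

Lemma left_derivative_line p v t : left_derivative (fun r => p + r *: v) t v.
Proof. by apply: derivative_line; exact: nbhs_left_neq. Qed.

Lemma timelike_line I J p v s1 s2 : convex_pair I J ->
  admissible I J (p - s1 *: v) (p + s2 *: v) -> 0 < s1 -> 1 < s2 ->
  timelike_curve I J (fun t => p + t *: v).
Proof.
move=> IJ adm s10 s21.
have s20 : 0 < s2 by exact: lt_trans s21.
(* The same segment seen from the moving point; [1 < s2] keeps this point before the end up to time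
   1. *)
have seg t : admissible I J (p + t *: v - (s1 + t) *: v)
    (p + t *: v + (s2 - t) *: v).
  have -> : p + t *: v - (s1 + t) *: v = p - s1 *: v.
    by apply/rowP => i; rewrite !mxE; ring.
  have -> // : p + t *: v + (s2 - t) *: v = p + s2 *: v.
  by apply/rowP => i; rewrite !mxE; ring.
have Op t : 0 <= t <= 1 -> Omega I J (p + t *: v).
  move=> /andP[t0 t1]; exists (p - s1 *: v), (p + s2 *: v); split => //.
  exists ((s1 + t) / (s1 + s2)); last by rewrite -line_param// addr_gt0.
  have d0 : 0 < s1 + s2 by rewrite addr_gt0.
  rewrite /= in_itv/= divr_gt0//=; last by rewrite ltr_pwDl.
  by rewrite ltr_pdivrMr// mul1r ltrD2l (le_lt_trans t1).
have cone t : 0 <= t <= 1 -> cone_at I J (p + t *: v) v.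
  move=> t01; have [t0 t1] := andP t01; apply/(cone_atP _ IJ (Op _ t01)); right.
  have admt := seg t; have JI := convex_pairC IJ.
  have [e1 e10 Ie] := admissible_beyond IJ admt.
  have [e2 e20 Je] := admissible_beyond JI (admissibleC admt).
  split; apply/dir_coneP.
    exists (s1 + t + e1 * (s1 + s2)); first by rewrite addr_gt0 ?ltr_pwDl ?mulr_gt0 ?addr_gt0.
    by move: Ie; congr (I _); apply/rowP => i; rewrite !mxE; ring.
  exists (s2 - t + e2 * (s1 + s2)).
    by rewrite addr_gt0 ?subr_gt0 ?(le_lt_trans t1) ?mulr_gt0 ?addr_gt0.
  by move: Je; congr (J _); apply/rowP => i; rewrite !mxE; ring.
split => //.
- exists [:: 1]; first by apply: itv_partition1.
  move=> [|//] _; exists (fun=> v); split => /=.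
  + by apply: continuous_subspaceT => t; exact: cvg_cst.
  + by move=> t _; exact: right_derivative_line.
  + by move=> t _; exact: left_derivative_line.
- move=> t v' /andP[t0 t1] rv.
  rewrite -(cvg_unique _ (@right_derivative_line p v t) rv)//.
  by apply: cone; rewrite t0 ltW.
- move=> t v' /andP[t0 t1] rv.
  rewrite -(cvg_unique _ (@left_derivative_line p v t) rv)//.
  by apply: cone; rewrite t1 ltW.
Qed.

(** At time [t] the distances to the ends, measured in units of [v], are [s1 + t] and [s2 - t], so
    the integrand is half the sum of their reciprocals. *)
Lemma curve_length_line I J p v s1 s2 : convex_pair I J ->
  admissible I J (p - s1 *: v) (p + s2 *: v) -> 0 < s1 -> 1 < s2 ->
  curve_length I J (fun t => p + t *: v) =
  (2^-1 * (ln (s1 + 1) - ln (s2 - 1)) - 2^-1 * (ln s1 - ln s2))%:E.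
Proof.
move=> IJ adm s10 s21.
have dsigma t : derive1 (fun t => p + t *: v) t = v.
  exact: vector_derive1_of_sides (@right_derivative_line p v t)
    (@left_derivative_line p v t).
have prim (c d : R) : primitive_on (fun t => c + d * t) (fun=> d) 0 1.
  have dk t : is_derive t (1 : R) (fun t => c + d * t) d.
    have := is_deriveD (is_derive_cst c t (1 : R))
      (is_deriveZ d (is_derive_id t (1 : R))).
    by rewrite add0r [d *: 1]mulr1.
  have ck : continuous (fun t => c + d * t).
    by move=> t; apply/differentiable_continuous/derivable1_diffP/ex_derive.
  split.
  - by apply: continuous_subspaceT => t; exact: cvg_cst.
  - split; first by move=> t _; exact: ex_derive.
    + by apply: cvg_at_right_filter; exact: ck.
    + by apply: cvg_at_left_filter; exact: ck.
  - by move=> t _; rewrite derive1E; apply: derive_val.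
have k1pos : {in `[0, 1], forall t, 0 < s2 + (-1) * t}.
  by move=> t; rewrite in_itv/= mulN1r subr_gt0 => /andP[_ /le_lt_trans]; apply.
have k2pos : {in `[0, 1], forall t, 0 < s1 + 1 * t}.
  by move=> t; rewrite in_itv/= mul1r => /andP[t0 _]; rewrite ltr_pwDl.
have [cphi dF FE] :=
  primitive_half_ln_ratio ltr01 (prim s2 (-1)) (prim s1 1) k1pos k2pos.
have := continuous_FTC2 ltr01 cphi dF FE.
rewrite !mulr1 !mulr0 !addr0 -EFinB => <-.
apply: eq_integral => t /set_mem t01; congr EFin; rewrite dsigma.
have s2t := k1pos _ t01; have s1t := k2pos _ t01.
rewrite (@f_H_admissible _ _ I J _ v (s1 + 1 * t) (s2 + (-1) * t))//.
  by rewrite mulN1r mul1r mulNr mul1r opprK addrC mul1r.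
have -> : p + t *: v - (s1 + 1 * t) *: v = p - s1 *: v.
  by apply/rowP => i; rewrite !mxE; ring.
have -> // : p + t *: v + (s2 + (-1) * t) *: v = p + s2 *: v.
by apply/rowP => i; rewrite !mxE; ring.
Qed.

Lemma delta_eq_H I J p q : convex_pair I J -> preceq I J p q ->
  (H I J p q)%:E = delta I J p q.
Proof.
move=> IJ [pltq|->]; last by rewrite /H /delta eqxx.
have [->|pq] := eqVneq p q; first by rewrite /H /delta eqxx.
have [a [b [s [t [adm [s0 [st t1]] pE qE ->]]]]] := H_formula pq pltq.
have JI := convex_pairC IJ.
rewrite /delta (negbTE pq); apply/eqP; rewrite eq_le; apply/andP; split.
  (* Lower bound: the segment from [p] to [q] is a competitor. Since [v] is [(t - s) *: (b - a)],
     dividing [s] and [1 - s] by [t - s] gives the parameters of the ends. *)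
  pose v := q - p.
  have ts0 : 0 < t - s by rewrite subr_gt0.
  have ts : t - s != 0 by rewrite gt_eqF.
  have s1 : 0 < s / (t - s) by rewrite divr_gt0.
  have s2 : 1 < (1 - s) / (t - s).
    by rewrite ltr_pdivlMr// mul1r ltrD2r.
  have adm' : admissible I J (p - (s / (t - s)) *: v) (p + ((1 - s) / (t - s)) *: v).
    have -> : p - (s / (t - s)) *: v = a.
      by rewrite /v pE qE; apply/rowP => i; rewrite !mxE; field.
    have -> // : p + ((1 - s) / (t - s)) *: v = b.
    by rewrite /v pE qE; apply/rowP => i; rewrite !mxE; field.
  apply: ereal_sup_ubound; exists (fun t => p + t *: v).
    split; first exact: timelike_line adm' s1 s2.
      by rewrite scale0r addr0.
    by rewrite scale1r /v addrC subrK.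
  rewrite (curve_length_line IJ adm' s1 s2); congr EFin.
  have ts0' : 0 < (t - s)^-1 by rewrite invr_gt0.
  rewrite -(half_ln_values s0 st t1 ts0' ts0').
  have -> : s / (t - s) + 1 = t * (t - s)^-1 by field.
  by have -> : (1 - s) / (t - s) - 1 = (1 - t) * (t - s)^-1 by field.
(* Upper bound: compare any timelike curve with hyperplanes supporting [J] at [b] and [I] at [a]. *)
apply: ge_ereal_sup => _ [sigma [tl sig0 sig1] <-].
have [[I0 J0] [oI oJ] [cI cJ] _] := IJ.
have [Ia Jb _ _ _] := adm.
have [u su] := supporting_exists J0 oJ cJ Jb.
have [w sw] := supporting_exists I0 oI cI Ia.
have [e e0 Ie] := admissible_beyond IJ adm.
have [e' e'0 Je] := admissible_beyond JI (admissibleC adm).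
(* Strict because the line continues beyond [b] into [J], where [u] is strictly smaller than at
   [b]. *)
have D0 : 0 < edot u (a - b).
  have [_ _ Ju] := su; have := Ju _ Je; rewrite /half_space/=.
  by move: (a - b) => z; rewrite edotBr edotZr gtrBl pmulr_rgt0.
have E0 : 0 < edot w (b - a).
  have [_ _ Iw] := sw; have := Iw _ Ie; rewrite /half_space/=.
  by move: (b - a) => z; rewrite edotBr edotZr gtrBl pmulr_rgt0.
have up : edot u p - edot u b = (1 - s) * edot u (a - b).
  by rewrite pE !edotDr edotNr !edotZr; ring.
have uq : edot u q - edot u b = (1 - t) * edot u (a - b).
  by rewrite qE !edotDr edotNr !edotZr; ring.
have wp : edot w p - edot w a = s * edot w (b - a).
  by rewrite pE !edotDr edotNr !edotZr; ring.
have wq : edot w q - edot w a = t * edot w (b - a).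
  by rewrite qE !edotDr edotNr !edotZr; ring.
rewrite -(half_ln_values s0 st t1 D0 E0) -up -uq -wp -wq -sig0 -sig1.
apply: (curve_length_le IJ tl su _ sw).
  by rewrite sig1 -subr_gt0 uq mulr_gt0// subr_gt0.
by rewrite sig0 -subr_gt0 wp mulr_gt0.
Qed.

End Segments.

Theorem theorem10p3 (R : realType) (n : nat) (I1 I2 : set 'rV[R]_n)
    (I1_nonempty : I1 !=set0) (I2_nonempty : I2 !=set0)
    (I1_open : open I1) (I2_open : open I2)
    (I1_convex : convex_set I1) (I2_convex : convex_set I2)
    (I_disjoint : I1 `&` I2 = set0)
    (K_disjoint : boundary I1 `&` boundary I2 = set0) :
  (forall p, Omega I1 I2 p ->
     timelike_Minkowski_functional (cone_at I1 I2 p `\` [set 0])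
       (f_H I1 I2 p)) /\
  (forall p q, Omega I1 I2 p -> Omega I1 I2 q -> preceq I1 I2 p q ->
     (H I1 I2 p q)%:E = delta I1 I2 p q).
Proof.
have I12 : convex_pair I1 I2 by split => //; exact: disjoint_closure.
split=> [p Op|p q _ _]; first exact: f_H_Minkowski.
exact: delta_eq_H.
Qed.
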